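(* For every $n\in\mathbb{N}$ and all Banach spaces $E_1,\ldots,E_n$ and $F$, the hyper-Borel transform $$\mathcal{B}_n\colon(\overline{\mathcal{L}_{\mathcal{F}}}(E_1,\ldots,E_n;F),\|\cdot\|)^*\longrightarrow(\mathcal{J}(\mathcal{L}(E_1,\ldots,E_n);F^* ),\|\cdot\|_{\mathcal{J}}),\quad \mathcal{B}_n(\phi)(A)(y)=\phi(A\otimes y),$$ is an isometric isomorphism (onto).
   Context: Banach spaces are over $\mathbb{K}=\mathbb{R}$ or $\mathbb{C}$. $\mathcal{L}(E_1,\ldots,E_n;F)$ is the Banach space of continuous $n$-linear operators with the usual operator norm $\|\cdot\|$; $\mathcal{L}(E_1,\ldots,E_n)$ is the case $F=\mathbb{K}$. For $A\in\mathcal{L}(E_1,\ldots,E_n)$, $y\in F$, $(A\otimes y)(x_1,\ldots,x_n)=A(x_1,\ldots,x_n)y$. $\overline{\mathcal{L}_{\mathcal{F}}}(E_1,\ldots,E_n;F)$ is the closure, in the usual operator norm, of the space of finite rank $n$-linear operators (linear combinations of operators $A\otimes y$), endowed with the usual operator norm. $(\mathcal{J},\|\cdot\|_{\mathcal{J}})$ is the Banach ideal of integral linear operators (in Grothendieck's sense): $u\in\mathcal{L}(X;Y)$ is integral if there is a regular Borel measure $\mu$ on the weak$^*$-compact space $B_{X^*}\times B_{Y^{**}}$ with $y^*(u(x))=\int x^*(x)\,y^{**}(y^* )\,d\mu(x^*,y^{**})$ for all $x\in X$, $y^*\in Y^*$, and $\|u\|_{\mathcal{J}}$ is the infimum of the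 total variations of such $\mu$. Here $B_X$ denotes the closed unit ball of $X$. *)

(* Defs.v *)
From HB Require Import structures.
From mathcomp Require Import all_boot all_order all_algebra.
From mathcomp Require Import all_classical all_reals all_analysis.
From mathcomp.real_closed Require Import complex.

Set Implicit Arguments.
Unset Strict Implicit.
Unset Printing Implicit Defensive.

Import Order.TTheory GRing.Theory Num.Theory.
Import numFieldNormedType.Exports.

Local Open Scope classical_set_scope.
Local Open Scope ring_scope.

Variant scalar_kind := RealScalars | ComplexScalars.

Definition scalar_field (R : realType) (k : scalar_kind) : numFieldType :=
  match k with
  | RealScalars => R
  | ComplexScalars => R[i]
  end.

Section Scalar.
Context {R : realType} {k : scalar_kind}.
Local Notation K := (scalar_field R k).

Definition scal_of_real : R -> K :=
  match k return R -> scalar_field R k with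
  | RealScalars => fun x => x
  | ComplexScalars => fun x => (x +i* 0)%C
  end.

Definition scal_re : K -> R :=
  match k return scalar_field R k -> R with
  | RealScalars => fun z => z
  | ComplexScalars => fun z => complex.Re z
  end.

Lemma scal_re_of_real x : scal_re (scal_of_real x) = x.
Proof. by rewrite /scal_re /scal_of_real; case: k. Qed.

Lemma scal_of_realD x y :
  scal_of_real (x + y) = scal_of_real x + scal_of_real y.
Proof.
rewrite /scal_of_real; case: k => //.
by apply/eqP; rewrite eq_complex /= addr0 !eqxx.
Qed.

Lemma scal_of_realM x y :
  scal_of_real (x * y) = scal_of_real x * scal_of_real y.
Proof.
rewrite /scal_of_real; case: k => //.
by apply/eqP; rewrite eq_complex /= !(mulr0, mul0r) subr0 addr0 !eqxx.
Qed.

Lemma scal_of_real0 : scal_of_real 0 = 0.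
Proof. by rewrite /scal_of_real; case: k. Qed.

Lemma scal_of_real1 : scal_of_real 1 = 1.
Proof. by rewrite /scal_of_real; case: k. Qed.

Lemma scal_of_real_inj : injective scal_of_real.
Proof. exact: can_inj scal_re_of_real. Qed.

Lemma scal_of_real_le x y : (scal_of_real x <= scal_of_real y) = (x <= y).
Proof. by rewrite /scal_of_real; case: k => //=; rewrite lecE /= eqxx. Qed.

Lemma scal_reK (z : K) : 0 <= z -> scal_of_real (scal_re z) = z.
Proof.
rewrite /scal_re /scal_of_real; case: k z => //= z.
by rewrite lecE /= => /andP[/eqP <- _]; case: z.
Qed.

End Scalar.

(* The norm of a normedModType over [scalar_field R k] takes its values in
   [scalar_field R k] itself, as a nonnegative element; [rnorm] is its value in R. *)
Definition rnorm {R : realType} {k : scalar_kind}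
  {V : normedZmodType (scalar_field R k)} (v : V) : R := scal_re `|v|.

Section Rnorm.
Context {R : realType} {k : scalar_kind}.
Local Notation K := (scalar_field R k).

Lemma rnormE (V : normedZmodType K) (v : V) : scal_of_real (rnorm v) = `|v|.
Proof. exact: scal_reK. Qed.

Lemma rnorm_ge0 (V : normedZmodType K) (v : V) : 0 <= rnorm v.
Proof. by rewrite -(@scal_of_real_le _ k) rnormE scal_of_real0. Qed.

Lemma rnormD (V : normedZmodType K) (v w : V) :
  rnorm (v + w) <= rnorm v + rnorm w.
Proof.
by rewrite -(@scal_of_real_le _ k) scal_of_realD !rnormE ler_normD.
Qed.

Lemma rnormM (x y : K) : rnorm (x * y) = rnorm x * rnorm y.
Proof.
by apply: (@scal_of_real_inj _ k); rewrite scal_of_realM !rnormE normrM.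
Qed.

Lemma rnormZ (V : normedModType K) (l : K) (v : V) :
  rnorm (l *: v) = rnorm l * rnorm v.
Proof.
by apply: (@scal_of_real_inj _ k); rewrite scal_of_realM !rnormE normrZ.
Qed.

Lemma rnorm0 (V : normedZmodType K) : rnorm (0 : V) = 0.
Proof.
by apply: (@scal_of_real_inj _ k); rewrite rnormE normr0 scal_of_real0.
Qed.

Lemma rnorm_eq0 (V : normedZmodType K) (v : V) : rnorm v = 0 -> v = 0.
Proof.
by move=> v0; apply/normr0_eq0; rewrite -rnormE v0 scal_of_real0.
Qed.

Lemma rnorm_le (V W : normedZmodType K) (v : V) (w : W) :
  (`|v| <= `|w|) = (rnorm v <= rnorm w).
Proof. by rewrite -!rnormE scal_of_real_le. Qed.

Lemma rnorm_of_real (x : R) : 0 <= x -> rnorm (scal_of_real x : K) = x.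
Proof.
move=> x0; apply: (@scal_of_real_inj _ k).
by rewrite rnormE ger0_norm// -scal_of_real0 scal_of_real_le.
Qed.

End Rnorm.

Definition sup_norm {R : realType} {k : scalar_kind}
    {V : normedModType (scalar_field R k)} {T : Type} (B : set T) (f : T -> V) : R :=
  sup [set rnorm (f x) | x in B].

Definition norm_bounded_on {R : realType} {k : scalar_kind}
    {V : normedModType (scalar_field R k)} {T : Type} (B : set T) (f : T -> V) :=
  exists M : R, forall x, B x -> rnorm (f x) <= M.

Section SupNorm.
Context {R : realType} {k : scalar_kind}.
Local Notation K := (scalar_field R k).
Context {V : normedModType K} {T : Type} {B : set T} (B0 : B !=set0).
Implicit Types f g : T -> V.

Lemma le_sup_norm f x : norm_bounded_on B f -> B x -> rnorm (f x) <= sup_norm B f.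
Proof.
move=> [M fM] Bx; apply: ub_le_sup; last by exists x.
by exists M => _ [y By <-]; exact: fM.
Qed.

Lemma sup_norm_le f M : (forall x, B x -> rnorm (f x) <= M) -> sup_norm B f <= M.
Proof.
move=> fM; apply: ge_sup; last by move=> _ [x Bx <-]; exact: fM.
by have [x Bx] := B0; exists (rnorm (f x)); exists x.
Qed.

Lemma sup_norm_ge0 f : norm_bounded_on B f -> 0 <= sup_norm B f.
Proof.
by have [x Bx] := B0 => bf; apply: (le_trans (rnorm_ge0 (f x))); exact: le_sup_norm.
Qed.

Lemma sup_normD f g : norm_bounded_on B f -> norm_bounded_on B g ->
  sup_norm B (f + g) <= sup_norm B f + sup_norm B g.
Proof.
move=> bf bg; apply: sup_norm_le => x Bx.
by apply: (le_trans (rnormD _ _)); apply: lerD; exact: le_sup_norm.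
Qed.

Lemma norm_bounded_onZ (l : K) f : norm_bounded_on B f -> norm_bounded_on B (l *: f).
Proof.
move=> [M fM]; exists (rnorm l * M) => x Bx.
by rewrite [_ x]/(l *: f x) rnormZ ler_wpM2l ?rnorm_ge0 ?fM.
Qed.

Lemma sup_normZ (l : K) f : norm_bounded_on B f ->
  sup_norm B (l *: f) = rnorm l * sup_norm B f.
Proof.
move=> bf.
have le (m : K) g : norm_bounded_on B g ->
    sup_norm B (m *: g) <= rnorm m * sup_norm B g.
  move=> bg; apply: sup_norm_le => x Bx; rewrite [_ x]/(m *: g x) rnormZ.
  by rewrite ler_wpM2l ?rnorm_ge0 ?le_sup_norm.
apply/eqP; rewrite eq_le le//=.
have [->|l0] := eqVneq l 0.
  rewrite rnorm0 mul0r sup_norm_ge0//; exact: norm_bounded_onZ.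
have rl : 0 < rnorm l.
  rewrite lt_neqAle rnorm_ge0 andbT eq_sym.
  by apply/negP => /eqP/rnorm_eq0/eqP; exact/negP.
rewrite -[leRHS]mul1r -(mulfV (lt0r_neq0 rl)) -mulrA ler_pM2l//.
rewrite (_ : (rnorm l)^-1 = rnorm (l^-1 : K)); last first.
  apply: (mulfI (lt0r_neq0 rl)); rewrite -rnormM mulfV ?lt0r_neq0// mulfV//.
  by rewrite -[1 in RHS](@scal_of_real1 R k) rnorm_of_real.
rewrite (_ : sup_norm B f = sup_norm B (l^-1 *: (l *: f))); last first.
  by rewrite scalerA mulVf// scale1r.
by apply: le; exact: norm_bounded_onZ.
Qed.

Lemma sup_norm_eq0 f : norm_bounded_on B f -> sup_norm B f = 0 ->
  forall x, B x -> f x = 0.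
Proof.
move=> bf f0 x Bx; apply/rnorm_eq0/eqP.
by rewrite eq_le rnorm_ge0 andbT -f0 le_sup_norm.
Qed.

End SupNorm.

Definition unit_ball {R : realType} {k : scalar_kind}
  (X : normedModType (scalar_field R k)) : set X := [set x | `|x| <= 1].
Arguments unit_ball {R k} X _ /.

Section ContinuousLinear.
Context {R : realType} {k : scalar_kind}.
Local Notation K := (scalar_field R k).
Context (X Y : normedModType K).

Definition clin_pred : {pred X -> Y} := fun f => `[< linear f /\ continuous f >].

Record clin := CLin { clin_fun :> X -> Y ; clin_funP : clin_fun \in clin_pred }.

Lemma clinP (f : X -> Y) : reflect (linear f /\ continuous f) (f \in clin_pred).
Proof. exact: asboolP. Qed.

HB.instance Definition _ := [isSub for clin_fun].
HB.instance Definition _ := [Choice of clin by <:].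

Lemma clin_subsemimod_closed : subsemimod_closed clin_pred.
Proof.
split; [split|] => [|f g /clinP[lf cf] /clinP[lg cg]|a f /clinP[lf cf]];
  apply/clinP; split.
- by move=> a u v; rewrite scaler0 addr0.
- exact: cst_continuous.
- move=> a u v.
  change (f (a *: u + v) + g (a *: u + v) = a *: (f u + g u) + (f v + g v)).
  by rewrite lf lg scalerDr addrACA.
- by move=> x; apply: continuousD; [exact: cf|exact: cg].
- move=> b u v; change (a *: f (b *: u + v) = b *: (a *: f u) + a *: f v).
  by rewrite lf scalerDr !scalerA mulrC.
- by move=> x; apply: continuousZl_tmp; exact: cf.
Qed.

HB.instance Definition _ :=
  GRing.SubChoice_isSubLmodule.Build K (X -> Y) clin_pred clin
    clin_subsemimod_closed.

Lemma unit_ball_neq0 : unit_ball X !=set0.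
Proof. by exists 0; rewrite /unit_ball/= normr0. Qed.

Lemma clin_linear (f : clin) : linear f.
Proof. by have /clinP[] := clin_funP f. Qed.

Lemma clin_continuous (f : clin) : continuous f.
Proof. by have /clinP[] := clin_funP f. Qed.

HB.instance Definition _ (f : clin) :=
  GRing.isLinear.Build K X Y *:%R (clin_fun f) (clin_linear f).

Lemma rnorm_le1 (V : normedModType K) (v : V) : (`|v| <= 1) = (rnorm v <= 1).
Proof. by rewrite -rnormE -[in LHS](@scal_of_real1 R k) scal_of_real_le. Qed.

Lemma clin_bounded (f : clin) : norm_bounded_on (unit_ball X) f.
Proof.
have bf : bounded_near f (nbhs (0 : X)).
  by apply: continuous_linear_bounded; exact: clin_continuous.
have [M fM] := (bounded_funP f).2 bf 1; exists (rnorm M) => x x1.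
have := fM x x1 => fxM; rewrite -rnorm_le ger0_norm//.
exact: le_trans (normr_ge0 _) fxM.
Qed.

Definition clin_norm (f : clin) : K :=
  scal_of_real (sup_norm (unit_ball X) f).

Lemma clin_normD (f g : clin) : clin_norm (f + g) <= clin_norm f + clin_norm g.
Proof.
rewrite -scal_of_realD scal_of_real_le.
exact: (sup_normD unit_ball_neq0 (@clin_bounded f) (@clin_bounded g)).
Qed.

Lemma clin_normZ (l : K) (f : clin) : clin_norm (l *: f) = `|l| * clin_norm f.
Proof.
rewrite -rnormE -scal_of_realM; congr scal_of_real.
exact: (sup_normZ unit_ball_neq0 l (@clin_bounded f)).
Qed.

Lemma clin_norm_eq0 (f : clin) : clin_norm f = 0 -> f = 0.
Proof.
rewrite -(@scal_of_real0 R k) => /scal_of_real_inj f0; apply/val_inj/funext => x.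
have f0x := sup_norm_eq0 (@clin_bounded f) f0.
have [->|x0] := eqVneq x 0; first exact: linear0.
have /f0x : unit_ball X (`|x|^-1 *: x) by rewrite /unit_ball/= normfZV.
rewrite linearZ/= => /eqP; rewrite scaler_eq0 invr_eq0 normr_eq0 (negbTE x0)/=.
by move/eqP.
Qed.

HB.instance Definition _ := @Lmodule_isNormed.Build K clin
  clin_norm clin_normD clin_normZ clin_norm_eq0.

Lemma clin_normE (f : clin) : `|f| = scal_of_real (sup_norm (unit_ball X) f).
Proof. by []. Qed.

Lemma clin_rnormE (f : clin) : rnorm f = sup_norm (unit_ball X) f.
Proof. by rewrite /rnorm clin_normE scal_re_of_real. Qed.

Lemma clin_rnorm_le (f : clin) x : rnorm (f x) <= rnorm f * rnorm x.
Proof.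
have [->|x0] := eqVneq x 0; first by rewrite linear0 !rnorm0 mulr0.
have nx0 : 0 < rnorm x.
  rewrite lt_neqAle rnorm_ge0 andbT eq_sym.
  by apply/negP => /eqP/rnorm_eq0/eqP; exact/negP.
have ub : unit_ball X (`|x|^-1 *: x) by rewrite /unit_ball/= normfZV.
have := le_sup_norm (clin_bounded f) ub; rewrite -clin_rnormE linearZ/= rnormZ.
rewrite (_ : rnorm (`|x|^-1) = (rnorm x)^-1) ?ler_pdivrMl//; first by rewrite mulrC.
apply: (mulfI (lt0r_neq0 nx0)); rewrite mulfV ?lt0r_neq0//.
rewrite -{1}(rnorm_of_real (k := k) (rnorm_ge0 x)) rnormE -rnormM.
by rewrite mulfV ?normr_eq0// -[1 in LHS](@scal_of_real1 R k) rnorm_of_real.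
Qed.

Lemma linear_bounded_clin_pred (f : X -> Y) (M : R) : linear f ->
  (forall x, rnorm (f x) <= M * rnorm x) -> f \in clin_pred.
Proof.
move=> lf fM; apply/clinP; split=> //.
pose hf := GRing.isLinear.Build K X Y *:%R f lf.
pose g : {linear X -> Y} := HB.pack f hf.
apply: (@bounded_linear_continuous _ _ _ g).
apply/(bounded_funP g).1 => r; exists (scal_of_real `|M| * `|r|) => x xr.
rewrite -rnormE -(rnormE r) -scal_of_realM scal_of_real_le.
apply: (le_trans (fM x)); apply: (le_trans (ler_wpM2r (rnorm_ge0 x) (ler_norm M))).
rewrite ler_wpM2l// -rnorm_le (le_trans xr)//.
by rewrite real_ler_norm// (ger0_real (le_trans _ xr)).
Qed.

End ContinuousLinear.

Definition multilinear {R : realType} {k : scalar_kind} {n : nat}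
    {E : 'I_n -> completeNormedModType (scalar_field R k)}
    {F : normedModType (scalar_field R k)} (f : (forall i, E i) -> F) :=
  forall (x : forall i, E i) (i : 'I_n),
    linear (fun u : E i => f (dfwith x i u)).

Definition unit_ball_prod {R : realType} {k : scalar_kind} {n : nat}
    (E : 'I_n -> completeNormedModType (scalar_field R k)) : set (forall i, E i) :=
  [set x | forall i, unit_ball (E i) (x i)].
Arguments unit_ball_prod {R k n} E _ /.

Section ContinuousMultilinear.
Context {R : realType} {k : scalar_kind}.
Local Notation K := (scalar_field R k).
Context {n : nat} (E : 'I_n -> completeNormedModType K) (F : normedModType K).
Local Notation Edom := (prod_topology (fun i => E i)).

Definition mlin_pred : {pred (forall i, E i) -> F} :=
  fun f => `[< multilinear f /\ continuous (f : Edom -> F) >].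

Record mlin := MLin {
  mlin_fun :> (forall i, E i) -> F ;
  mlin_funP : mlin_fun \in mlin_pred }.

Lemma mlinP (f : (forall i, E i) -> F) :
  reflect (multilinear f /\ continuous (f : Edom -> F)) (f \in mlin_pred).
Proof. exact: asboolP. Qed.

HB.instance Definition _ := [isSub for mlin_fun].
HB.instance Definition _ := [Choice of mlin by <:].

Lemma mlin_subsemimod_closed : subsemimod_closed mlin_pred.
Proof.
split; [split|] => [|f g /mlinP[lf cf] /mlinP[lg cg]|a f /mlinP[lf cf]];
  apply/mlinP; split.
- by move=> x i a u v; rewrite scaler0 addr0.
- exact: cst_continuous.
- move=> x i a u v.
  change (f (dfwith x i (a *: u + v)) + g (dfwith x i (a *: u + v)) =
    a *: (f (dfwith x i u) + g (dfwith x i u)) + (f (dfwith x i v) + g (dfwith x i v))).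
  by rewrite [f _]lf [g _]lg scalerDr addrACA.
- by move=> x; apply: continuousD; [exact: cf|exact: cg].
- move=> x i b u v; change (a *: f (dfwith x i (b *: u + v)) =
    b *: (a *: f (dfwith x i u)) + a *: f (dfwith x i v)).
  by rewrite [f _]lf scalerDr !scalerA mulrC.
- by move=> x; apply: continuousZl_tmp; exact: cf.
Qed.

HB.instance Definition _ :=
  GRing.SubChoice_isSubLmodule.Build K ((forall i, E i) -> F) mlin_pred mlin
    mlin_subsemimod_closed.

Lemma unit_ball_prod_neq0 : unit_ball_prod E !=set0.
Proof. by exists (fun=> 0) => i; rewrite /unit_ball/= normr0. Qed.

Lemma mlin_multilinear (f : mlin) : multilinear f.
Proof. by have /mlinP[] := mlin_funP f. Qed.

Lemma mlin_continuous (f : mlin) : continuous (f : Edom -> F).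
Proof. by have /mlinP[] := mlin_funP f. Qed.

Lemma mlin_scale (f : mlin) (c : 'I_n -> K) (x : forall i, E i) :
  f (fun i => c i *: x i) = (\prod_i c i) *: f x.
Proof.
pose y (s : seq 'I_n) : forall i, E i :=
  fun i => if i \in s then c i *: x i else x i.
suff H (s : seq 'I_n) : uniq s -> f (y s) = (\prod_(i <- s) c i) *: f x.
  rewrite -(H (index_enum _) (index_enum_uniq _)); congr (mlin_fun f _).
  by apply: functional_extensionality_dep => i; rewrite /y mem_index_enum.
elim: s => [_|i s IH /= /andP[nis us]].
  by rewrite big_nil scale1r; congr (mlin_fun f _).
have lin := @mlin_multilinear f (y s) i.
have yi : y s = dfwith (y s) i (x i).
  apply: functional_extensionality_dep => j; case: dfwithP => //.
  by rewrite /y (negbTE nis).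
have -> : y (i :: s) = dfwith (y s) i (c i *: x i + 0).
  apply: functional_extensionality_dep => j; case: dfwithP => [|j' ij].
    by rewrite /y inE eqxx addr0.
  by rewrite /y inE eq_sym (negbTE ij).
rewrite [LHS]lin.
have -> : f (dfwith (y s) i 0) = 0.
  by have := lin (-1) 0 0; rewrite scaler0 addr0 scaleN1r addNr.
by rewrite addr0 -yi IH// big_cons scalerA.
Qed.

Lemma mlin_bounded (f : mlin) : norm_bounded_on (unit_ball_prod E) f.
Proof.
have [d d0 fd] : exists2 d : K, 0 < d & forall x : forall i, E i,
    (forall i, `|x i| < d) -> `|f (fun=> 0) - f x| < 1.
  pose G : set_system Edom := filter_from [set d : K | 0 < d]
    (fun d => [set x | forall i, `|x i| < d]).
  have FG : Filter G.
    apply: filter_from_filter; first by exists 1 => /=.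
    move=> d e /= d0 e0.
    have dde : d * e / (d + e) <= d.
      by rewrite -mulrA ler_piMr ?(ltW d0)// ler_pdivrMr ?addr_gt0// mul1r lerDr ltW.
    have dee : d * e / (d + e) <= e.
      by rewrite mulrAC ler_piMl ?(ltW e0)// ler_pdivrMr ?addr_gt0// mul1r lerDl ltW.
    exists (d * e / (d + e)); first by rewrite /= divr_gt0 ?mulr_gt0 ?addr_gt0.
    by move=> x /= xde; split=> i; exact: lt_le_trans (xde i) _.
  have G0 : G --> ((fun=> 0) : Edom).
    apply/cvg_sup => i A [B [[C oC <-] /= C0 CA]].
    have : nbhs (0 : E i) C by apply: open_nbhs_nbhs; split.
    move=> /nbhs_normP[e /= e0 eC]; exists e => //= x xe; apply: CA => /=.
    by apply: (eC (x i)); rewrite /ball_/= sub0r normrN; exact: xe.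
  have := @mlin_continuous f (fun=> 0) => /cvgrPdist_lt /(_ 1 ltr01) N.
  by have [d d0 dN] := G0 _ N; exists d.
pose t : K := d / 2.
have t0 : 0 < t by rewrite divr_gt0.
pose M : K := (\prod_(i < n) t)^-1 * (1 + `|f (fun=> 0)|).
exists (rnorm M) => x Bx; rewrite -rnorm_le.
have P0 : 0 < \prod_(i < n) t by exact: prodr_gt0.
have /fd : forall i, `|t *: x i| < d.
  move=> i; rewrite normrZ gtr0_norm//; apply: (@le_lt_trans _ _ t).
    by rewrite ler_piMr ?(ltW t0)//; exact: Bx.
  by rewrite /t ltr_pdivrMr// ltr_pMr// ltr1n.
rewrite (mlin_scale f (fun=> t)) => fx.
rewrite [leRHS]ger0_norm; last by rewrite mulr_ge0 ?invr_ge0 ?(ltW P0)// addr_ge0.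
rewrite /M ler_pdivlMl// -[X in X * _](gtr0_norm P0) -normrZ.
rewrite -[X in `|X|](subrK (f (fun=> 0))).
by apply: (le_trans (ler_normD _ _)); rewrite lerD2r distrC ltW.
Qed.

Definition mlin_norm (f : mlin) : K :=
  scal_of_real (sup_norm (unit_ball_prod E) f).

Lemma mlin_normD (f g : mlin) : mlin_norm (f + g) <= mlin_norm f + mlin_norm g.
Proof.
rewrite -scal_of_realD scal_of_real_le.
exact: (sup_normD unit_ball_prod_neq0 (@mlin_bounded f) (@mlin_bounded g)).
Qed.

Lemma mlin_normZ (l : K) (f : mlin) : mlin_norm (l *: f) = `|l| * mlin_norm f.
Proof.
rewrite -rnormE -scal_of_realM; congr scal_of_real.
exact: (sup_normZ unit_ball_prod_neq0 l (@mlin_bounded f)).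
Qed.

Lemma mlin_norm_eq0 (f : mlin) : mlin_norm f = 0 -> f = 0.
Proof.
rewrite -(@scal_of_real0 R k) => /scal_of_real_inj f0; apply/val_inj/funext => x.
pose c i : K := if x i == 0 then 1 else `|x i|.
have c0 i : c i != 0.
  by rewrite /c; case: (eqVneq (x i) 0) => [_|xi]; rewrite ?oner_neq0 ?normr_eq0.
have -> : x = (fun i => c i *: ((c i)^-1 *: x i)).
  by apply: functional_extensionality_dep => i; rewrite scalerA mulfV// scale1r.
rewrite [LHS](mlin_scale f c).
rewrite (sup_norm_eq0 (@mlin_bounded f) f0) ?scaler0// => i.
rewrite /unit_ball/= /c; case: eqVneq => [->|xi]; first by rewrite scaler0 normr0.
by rewrite normfZV.
Qed.

HB.instance Definition _ := @Lmodule_isNormed.Build K mlin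
  mlin_norm mlin_normD mlin_normZ mlin_norm_eq0.

Lemma mlin_rnormE (f : mlin) : rnorm f = sup_norm (unit_ball_prod E) f.
Proof. by rewrite /rnorm [`|f|]/(scal_of_real _) scal_re_of_real. Qed.

End ContinuousMultilinear.

Section FiniteRank.
Context {R : realType} {k : scalar_kind}.
Local Notation K := (scalar_field R k).
Context {n : nat} {E : 'I_n -> completeNormedModType K} {F : normedModType K}.

Lemma tens_subproof (A : mlin E K^o) (y : F) :
  (fun x : forall i, E i => A x *: y) \in @mlin_pred R k n E F.
Proof.
apply/mlinP; split=> [x i a u v|x].
  by rewrite [A _]mlin_multilinear scalerDl -scalerA.
have h := @mlin_continuous R k n E K^o A x; by apply: continuousZr_tmp; exact: h.
Qed.

Definition tens (A : mlin E K^o) (y : F) : mlin E F := MLin (tens_subproof A y).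

Definition finite_rank : set (mlin E F) :=
  [set T | exists (m : nat) (c : 'I_m -> K) (A : 'I_m -> mlin E K^o) (y : 'I_m -> F),
    T = \sum_(j < m) c j *: tens (A j) (y j)].

Definition fr_closure_pred : {pred mlin E F} := fun T => `[< closure finite_rank T >].

Lemma finite_rank0 : finite_rank 0.
Proof.
by exists 0%N, (fun=> 0), (fun=> 0), (fun=> 0); rewrite big_ord0.
Qed.

Lemma finite_rankD S T : finite_rank S -> finite_rank T -> finite_rank (S + T).
Proof.
move=> [m [c [A [y ->]]]] [p [d [B [z ->]]]].
pose glue (X : Type) (f : 'I_m -> X) (g : 'I_p -> X) (j : 'I_(m + p)) :=
  match fintype.split j with inl a => f a | inr b => g b end.
exists (m + p)%N, (glue _ c d), (glue _ A B), (glue _ y z).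
rewrite big_split_ord/=; congr (_ + _); apply: eq_bigr => j _; rewrite /glue.
- by rewrite (unsplitK (inl j)).
- by rewrite (unsplitK (inr j)).
Qed.

Lemma finite_rankZ a T : finite_rank T -> finite_rank (a *: T).
Proof.
move=> [m [c [A [y ->]]]]; exists m, (fun j => a * c j), A, y.
by rewrite scaler_sumr; apply: eq_bigr => j _; rewrite scalerA.
Qed.

Lemma fr_closureP (T : mlin E F) :
  reflect (closure finite_rank T) (T \in fr_closure_pred).
Proof. exact: asboolP. Qed.

Lemma fr_closure_eps (T : mlin E F) : closure finite_rank T <->
  forall e : K, 0 < e -> exists2 S, finite_rank S & `|T - S| < e.
Proof.
split=> [cT e e0|H B /nbhs_normP[e /= e0 eB]].
  have [|S [fS TS]] := cT (ball_ Num.Def.normr T e); last by exists S.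
  by apply/(@nbhs_normP K (mlin E F)); exists e.
by have [S fS TS] := H e e0; exists S; split=> //; exact: eB.
Qed.

Lemma fr_closure_subsemimod_closed : subsemimod_closed fr_closure_pred.
Proof.
split; [split|] => [|S T /fr_closureP/fr_closure_eps cS /fr_closureP/fr_closure_eps cT|
    a T /fr_closureP/fr_closure_eps cT]; apply/fr_closureP.
- by apply: subset_closure; exact: finite_rank0.
- apply/fr_closure_eps => e e0; have e20 : 0 < e / 2 by rewrite divr_gt0.
  have [S' fS SS'] := cS _ e20; have [T' fT TT'] := cT _ e20.
  exists (S' + T'); first exact: finite_rankD.
  by rewrite opprD addrACA (splitr e) (le_lt_trans (ler_normD _ _))// ltrD.
- apply/fr_closure_eps => e e0.
  have a0 : 0 < `|a| + 1 by rewrite ltr_wpDl.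
  have [T' fT TT'] := cT (e / (`|a| + 1)) (divr_gt0 e0 a0).
  exists (a *: T'); first exact: finite_rankZ.
  rewrite -scalerBr normrZ (@le_lt_trans _ _ ((`|a| + 1) * `|T - T'|))//.
    by rewrite ler_wpM2r// lerDl.
  by rewrite mulrC -ltr_pdivlMr.
Qed.

End FiniteRank.

Section FiniteRankClosure.
Context {R : realType} {k : scalar_kind}.
Local Notation K := (scalar_field R k).
Context {n : nat} (E : 'I_n -> completeNormedModType K) (F : normedModType K).

Record fr_closure := FRClosure {
  fr_closure_val :> mlin E F ;
  fr_closure_valP : fr_closure_val \in fr_closure_pred }.

HB.instance Definition _ := [isSub for fr_closure_val].
HB.instance Definition _ := [Choice of fr_closure by <:].
HB.instance Definition _ :=
  GRing.SubChoice_isSubLmodule.Build K (mlin E F) fr_closure_pred fr_closure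
    fr_closure_subsemimod_closed.

Definition fr_closure_norm (T : fr_closure) : K := `|fr_closure_val T|.

Lemma fr_closure_normD (S T : fr_closure) :
  fr_closure_norm (S + T) <= fr_closure_norm S + fr_closure_norm T.
Proof. exact: ler_normD. Qed.

Lemma fr_closure_normZ (l : K) (T : fr_closure) :
  fr_closure_norm (l *: T) = `|l| * fr_closure_norm T.
Proof. exact: normrZ. Qed.

Lemma fr_closure_norm_eq0 (T : fr_closure) : fr_closure_norm T = 0 -> T = 0.
Proof. by move=> /normr0_eq0 T0; apply: val_inj. Qed.

HB.instance Definition _ := @Lmodule_isNormed.Build K fr_closure
  fr_closure_norm fr_closure_normD fr_closure_normZ fr_closure_norm_eq0.

End FiniteRankClosure.

Definition dual {R : realType} {k : scalar_kind}
  (X : normedModType (scalar_field R k)) : normedModType (scalar_field R k) :=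
  clin X (scalar_field R k)^o.

Section HyperBorel.
Context {R : realType} {k : scalar_kind}.
Local Notation K := (scalar_field R k).
Context {n : nat} {E : 'I_n -> completeNormedModType K} {F : normedModType K}.

Lemma tens_fr_closure (A : mlin E K^o) (y : F) : tens A y \in fr_closure_pred.
Proof.
apply/fr_closureP; apply: subset_closure.
exists 1%N, (fun=> 1), (fun=> A), (fun=> y).
by rewrite big_ord1 scale1r.
Qed.

Definition fr_tens (A : mlin E K^o) (y : F) : fr_closure E F :=
  FRClosure (tens_fr_closure A y).

Lemma fr_tens_linearl y : linear (fun A : mlin E K^o => fr_tens A y).
Proof.
move=> a A B; do 2 apply: val_inj; apply/funext => x /=.
exact: (etrans (scalerDl _ _ _) (congr1 (fun z => z + _) (esym (scalerA _ _ _)))).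
Qed.

Lemma fr_tens_linearr A : linear (fr_tens A).
Proof.
move=> a y z; do 2 apply: val_inj; apply/funext => x /=.
change (A x *: (a *: y + z) = a *: (A x *: y) + A x *: z).
by rewrite scalerDr !scalerA mulrC.
Qed.

Lemma rnorm_fr_tens A y : rnorm (fr_tens A y) <= rnorm A * rnorm y.
Proof.
change (rnorm (tens A y) <= rnorm A * rnorm y).
rewrite mlin_rnormE; apply: (sup_norm_le (@unit_ball_prod_neq0 _ _ _ E)) => x Bx /=.
rewrite rnormZ ler_wpM2r ?rnorm_ge0// mlin_rnormE.
exact: (le_sup_norm (mlin_bounded A)).
Qed.

Lemma hyper_borel_bound (phi : dual (fr_closure E F)) A y :
  rnorm (phi (fr_tens A y)) <= rnorm phi * rnorm A * rnorm y.
Proof.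
apply: (le_trans (clin_rnorm_le _ _)); rewrite -mulrA.
by rewrite ler_wpM2l ?rnorm_ge0// rnorm_fr_tens.
Qed.

Lemma hyper_borel_inner_subproof (phi : dual (fr_closure E F)) (A : mlin E K^o) :
  (fun y : F => phi (fr_tens A y)) \in @clin_pred R k F K^o.
Proof.
apply: (@linear_bounded_clin_pred _ _ _ _ _ (rnorm phi * rnorm A)).
  by move=> a y z; rewrite fr_tens_linearr linearP.
by move=> y; exact: hyper_borel_bound.
Qed.

Definition hyper_borel_inner phi A : dual F := CLin (hyper_borel_inner_subproof phi A).

Lemma hyper_borel_subproof (phi : dual (fr_closure E F)) :
  hyper_borel_inner phi \in @clin_pred R k (mlin E K^o) (dual F).
Proof.
apply: (@linear_bounded_clin_pred _ _ _ _ _ (rnorm phi)).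
  move=> a A B; apply: val_inj; apply/funext => y /=.
  change (phi (fr_tens (a *: A + B) y) = a *: phi (fr_tens A y) + phi (fr_tens B y)).
  by rewrite fr_tens_linearl linearP.
move=> A; rewrite clin_rnormE; apply: (sup_norm_le (@unit_ball_neq0 _ _ F)) => y /= y1.
apply: (le_trans (hyper_borel_bound _ _ _)).
by rewrite ler_piMr ?mulr_ge0 ?rnorm_ge0// -rnorm_le1.
Qed.

Definition hyper_borel (phi : dual (fr_closure E F)) : clin (mlin E K^o) (dual F) :=
  CLin (hyper_borel_subproof phi).

Lemma hyper_borelE (phi : dual (fr_closure E F)) (A : mlin E K^o) (y : F) :
  hyper_borel phi A y = phi (fr_tens A y).
Proof. by []. Qed.

End HyperBorel.

(* Generated by all open sets: on a product this is the Borel sigma-algebra of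
   the product topology, in general larger than the product sigma-algebra. *)
Definition borel (T : ptopologicalType) : measurableType _ :=
  g_sigma_algebraType (@open T).

(* A complex measure is the pair of its real and imaginary parts; charges take
   finite values on measurable sets. *)
Definition scalar_measure (R : realType) (k : scalar_kind) (T : ptopologicalType)
    : Type :=
  match k with
  | RealScalars => {charge set (borel T) -> \bar R}
  | ComplexScalars =>
      ({charge set (borel T) -> \bar R} * {charge set (borel T) -> \bar R})%type
  end.

(* The Jordan decomposition does not depend on the chosen Hahn decomposition. *)
Definition charge_integral {d} {T : measurableType d} {R : realType}
    (nu : {charge set T -> \bar R}) (f : T -> R) : R :=
  let NP := cid (svalP (cid (Hahn_decomposition nu))) in
  \int[jordan_pos (svalP NP)]_x f x - \int[jordan_neg (svalP NP)]_x f x.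

Section ScalarMeasure.
Context {R : realType} {k : scalar_kind} {T : ptopologicalType}.
Local Notation K := (scalar_field R k).

Definition measure_value : scalar_measure R k T -> set T -> K :=
  match k return scalar_measure R k T -> set T -> scalar_field R k with
  | RealScalars => fun nu A => fine (nu A)
  | ComplexScalars => fun nu A => (fine (nu.1 A) +i* fine (nu.2 A))%C
  end.

Definition measure_integral : scalar_measure R k T -> (T -> K) -> K :=
  match k return scalar_measure R k T -> (T -> scalar_field R k) -> scalar_field R k with
  | RealScalars => fun nu f => charge_integral nu f
  | ComplexScalars => fun nu f =>
      ((charge_integral nu.1 (fun t => complex.Re (f t)) -
        charge_integral nu.2 (fun t => complex.Im (f t))) +i*
       (charge_integral nu.1 (fun t => complex.Im (f t)) +
        charge_integral nu.2 (fun t => complex.Re (f t))))%C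
  end.

Definition variation (mu : scalar_measure R k T) (A : set T) : \bar R :=
  ereal_sup [set v | exists (m : nat) (P : 'I_m -> set (borel T)),
    [/\ forall j, measurable (P j), trivIset setT P, \bigcup_j P j = A &
        v = (\sum_(j < m) (rnorm (measure_value mu (P j)))%:E)%E]].

Definition regular_measure (mu : scalar_measure R k T) :=
  forall (A : set (borel T)) (e : R), measurable A -> 0 < e ->
    exists (C U : set T), [/\ compact C, open U, C `<=` A, A `<=` U &
      (variation mu (U `\` C) <= e%:E)%E].

End ScalarMeasure.

(* This join is missing from the library. *)
HB.instance Definition _ (S T : ptopologicalType) := Pointed.on (S * T)%type.

Section DualBall.
Context {R : realType} {k : scalar_kind}.
Local Notation K := (scalar_field R k).

(* The coarsest topology on the dual making all evaluations continuous. *)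
Definition weak_star (X : normedModType K) : Type :=
  initial_topology (fun f : dual X => (f : {ptws X -> K^o})).

HB.instance Definition _ (X : normedModType K) := Topological.on (weak_star X).

Definition dual_ball (X : normedModType K) : Type :=
  set_type [set f : weak_star X | unit_ball (dual X) f].

HB.instance Definition _ (X : normedModType K) := Topological.on (dual_ball X).

Definition dual_ball0 (X : normedModType K) : dual_ball X.
Proof. by exists (0 : dual X); rewrite inE /= normr0. Defined.

HB.instance Definition _ (X : normedModType K) :=
  isPointed.Build (dual_ball X) (dual_ball0 X).

Definition dual_ball_val (X : normedModType K) (f : dual_ball X) : dual X :=
  set_val f.

End DualBall.

Section Integral.
Context {R : realType} {k : scalar_kind}.
Local Notation K := (scalar_field R k).
Context {X Y : normedModType K}.

Definition represents (mu : scalar_measure R k (dual_ball X * dual_ball (dual Y))%type)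
    (u : clin X Y) :=
  forall (x : X) (y' : dual Y),
    y' (u x) = measure_integral mu
      (fun p => dual_ball_val p.1 x * dual_ball_val p.2 y').

Definition integral_op (u : clin X Y) :=
  exists2 mu, regular_measure mu & represents mu u.

Definition integral_norm (u : clin X Y) : \bar R :=
  ereal_inf [set variation mu setT | mu in
    [set mu | regular_measure mu /\ represents mu u]].

End Integral.

(* Main.v *)
(* Let X be the space of n-linear forms, Omega the product of the unit balls of X^* and
   F^***, and u the transform of phi.  For A_1, ..., A_m in X and y_1, ..., y_m in the
   bidual of F, the real part of \sum_j y_j(u A_j) is at most |phi| times the supremum
   over Omega of the real part of \sum_j p(A_j) q(y_j): for y_j in F this is because the
   points of the ball and of F^* give points of Omega, and the balls are balanced; the
   general case is a finite-dimensional local reflexivity argument.  Hahn-Banach then gives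
   a functional on the bounded functions on Omega dominated by |phi| sup, hence positive,
   and the Riesz-Markov theorem represents it by a positive regular measure of mass at
   most |phi|.
   Conversely, if mu represents u, then \sum_j u(A_j)(y_j) is the integral of a function
   on Omega bounded by the operator norm of \sum_j A_j (x) y_j, so it is at most |mu| times
   this norm, and u comes from a functional of norm at most |mu|. *)

Require Import Defs.
From HB Require Import structures.
From mathcomp Require Import all_boot all_order all_algebra.
From mathcomp Require Import all_classical all_reals all_analysis.
From mathcomp.real_closed Require Import complex.
From mathcomp Require Import measurable_realfun finmap ring lra.

Set Implicit Arguments.
Unset Strict Implicit.
Unset Printing Implicit Defensive.

Import Order.TTheory GRing.Theory Num.Theory.
Import numFieldNormedType.Exports.

Local Open Scope classical_set_scope.
Local Open Scope ring_scope.

(** * Hahn-Banach theorem *)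

(** The obstacle is the bidual in the second factor: [phi] sees only vectors of F, whereas a
    representing measure is tested on all of F^**. Finitely many bounded forms send the unit balls
    into a bounded subset of a finite-dimensional space, so finitely many points of the balls
    suffice up to a small error, and a Hahn-Banach extension in a finite power of F produces
    functionals in F^*, on which elements of the bidual can be evaluated. Omega is stable under
    unimodular scalars, so one-sided bounds on real parts lose nothing; they lead to a positive
    measure, whose total variation is its mass, in the complex case too. Partial functionals are
    handled as relations throughout: being dominated already makes them single-valued, so a
    functional can be prescribed on sums of tensors without choosing representatives. The converse
    uses two estimates of an integral. A crude finite constant, the mass of the Jordan parts,
    suffices to recover a functional from an integral operator; the total variation, reached through
    simple functions, is used only for the sharp norm. *)

Section HahnBanach.
Context {R : realType} {k : scalar_kind}.
Local Notation K := (scalar_field R k).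
Local Notation r2K := (@scal_of_real R k).

(** Partial functionals are encoded as graphs, so that unions of chains and the adjunction of a
    vector are operations on sets. Real scalars act through [r2K], which treats a complex space as a
    real one. *)
Definition real_linear_rel (V : lmodType K) (G : set (V * R)) :=
  G (0, 0) /\ forall t v c w d, G (v, c) -> G (w, d) ->
    G (r2K t *: v + w, t * c + d).

Definition real_sublinear (V : lmodType K) (p : V -> R) :=
  (forall v w, p (v + w) <= p v + p w) /\
  (forall t v, 0 < t -> p (r2K t *: v) = t * p v).

Lemma scal_of_realN x : r2K (- x) = - r2K x.
Proof.
by apply/eqP; rewrite -addr_eq0 -scal_of_realD addNr scal_of_real0.
Qed.

Section Extension.
Variables (V : lmodType K) (p : V -> R).
Hypothesis psub : real_sublinear p.
Implicit Type G : set (V * R).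

Definition dominated G := forall v c, G (v, c) -> c <= p v.

Lemma real_linear_relZ G t v c : real_linear_rel G -> G (v, c) ->
  G (r2K t *: v, t * c).
Proof. by move=> [G0 GD] Gv; have := GD t _ _ _ _ Gv G0; rewrite !addr0. Qed.

Lemma real_linear_relD G v c w d : real_linear_rel G -> G (v, c) -> G (w, d) ->
  G (v + w, c + d).
Proof.
move=> [G0 GD] Gv Gw; have := GD 1 _ _ _ _ Gv Gw.
by rewrite scal_of_real1 scale1r mul1r.
Qed.

(** Two values c and d at [v] give the values c - d and d - c at 0, where [p] vanishes because p(0)
    = p(2 * 0) = 2 p(0). *)
Lemma dominated_functional G v c d : real_linear_rel G -> dominated G ->
  G (v, c) -> G (v, d) -> c = d.
Proof.
move=> lG dG Gc Gd.
have le0 a : G (0, a) -> a <= 0.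
  move=> /(real_linear_relZ 2 lG) G2a; have := dG _ _ G2a.
  have := psub.2 2 0 (ltr0Sn _ 1); rewrite scaler0 => p0.
  have -> : p 0 = 0 by lra.
  by move=> ?; lra.
have H a b : G (v, a) -> G (v, b) -> a <= b.
  move=> Ga Gb; rewrite -subr_le0; apply: le0.
  have := real_linear_relD lG Ga (real_linear_relZ (-1) lG Gb).
  by rewrite scal_of_realN scal_of_real1 scaleN1r subrr mulN1r.
by apply/eqP; rewrite eq_le !H.
Qed.

(** A value at [v0] must lie above every c - p(w - v0) and below every p(w' + v0) - c', for (w, c)
    and (w', c') in the graph. The two families are ordered, since c + c' <= p(w + w') <= p(w - v0)
    + p(w' + v0); the supremum of the lower one is chosen. Other multiples of [v0] follow by
    rescaling. *)
Lemma hahn_banach_step G (v0 : V) : real_linear_rel G -> dominated G ->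
  exists a, dominated [set vc | exists w c t, G (w, c) /\
    vc = (w + r2K t *: v0, c + t * a)].
Proof.
move=> lG dG.
pose S := [set vc.2 - p (vc.1 - v0) | vc in G].
have Sub w' c' : G (w', c') -> ubound S (p (w' + v0) - c').
  move=> Gw' _ [[w c] /= Gw <-].
  rewrite lerBlDr addrAC lerBrDr (le_trans (dG _ _ (real_linear_relD lG Gw Gw')))//.
  rewrite addrC; apply: le_trans (psub.1 _ _).
  by rewrite addrACA addNr addr0 addrC.
have S0 : S !=set0 by exists (0 - p (0 - v0)); exists (0, 0) => //; exact: lG.1.
exists (sup S) => _ _ [w [c [t [Gw [-> ->]]]]].
have [t0|t0|->] := ltgtP t 0; last first.
- by rewrite scal_of_real0 scale0r mul0r !addr0; exact: dG.
- have : sup S <= p (r2K t^-1 *: w + v0) - t^-1 * c.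
    by apply: ge_sup => //; apply: Sub; exact: real_linear_relZ.
  rewrite -(ler_pM2l t0) mulrBr mulrA mulfV ?gt_eqF// mul1r -psub.2//.
  rewrite scalerDr scalerA -scal_of_realM mulfV ?gt_eqF// scal_of_real1 scale1r.
  by rewrite lerBrDr addrC.
- have t1 : 0 < - t by rewrite oppr_gt0.
  have : (- t)^-1 * c - p (r2K (- t)^-1 *: w - v0) <= sup S.
    apply: ub_le_sup.
      by exists (p (0 + v0) - 0); exact: (Sub _ _ lG.1).
    by exists (r2K (- t)^-1 *: w, (- t)^-1 * c) => //; exact: real_linear_relZ.
  rewrite -(ler_pM2l t1) mulrBr mulrA mulfV ?gt_eqF// mul1r -psub.2//.
  rewrite scalerBr scalerA -scal_of_realM mulfV ?gt_eqF// scal_of_real1 scale1r.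
  by rewrite scal_of_realN scaleNr opprK mulNr lerBlDr addrC -lerBlDr opprK.
Qed.

Theorem hahn_banach_real G : real_linear_rel G -> dominated G ->
  exists g : V -> R, [/\ forall v w, g (v + w) = g v + g w,
    forall t v, g (r2K t *: v) = t * g v, forall v, g v <= p v &
    forall v c, G (v, c) -> g v = c].
Proof.
move=> lG dG.
(* Imposing the conditions on the union with [G] lets the empty chain through in Zorn's lemma: its
   union is empty and gives back [G]. *)
pose P (A : set (V * R)) := [/\ A `<=` A `|` G, real_linear_rel (A `|` G) &
  dominated (A `|` G)].
have [F FP totF|A [[_ lA dA] maxA]] := @Zorn_bigcup _ P.
  have key vc wd : ((\bigcup_(X in F) X) `|` G) vc -> ((\bigcup_(X in F) X) `|` G) wd ->
    exists X, [/\ real_linear_rel X, X vc, X wd & X `<=` (\bigcup_(X in F) X) `|` G].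
    have sub X : F X -> X `|` G `<=` (\bigcup_(X in F) X) `|` G.
      by move=> FX x [Xx|]; [left; exists X|right].
    move=> [[X FX Xv]|Gv] [[Y FY Yw]|Gw].
    - have [XY|YX] := totF X Y FX FY.
        have [_ lY _] := FP _ FY.
        by exists (Y `|` G); split=> //; [left; exact: XY|left|exact: sub].
      have [_ lX _] := FP _ FX.
      by exists (X `|` G); split=> //; [left|left; exact: YX|exact: sub].
    - have [_ lX _] := FP _ FX.
      by exists (X `|` G); split=> //; [left|right|exact: sub].
    - have [_ lY _] := FP _ FY.
      by exists (Y `|` G); split=> //; [right|left|exact: sub].
    - by exists G; split=> // x; right.
  split=> [x|| v c]; first by left.
  - split=> [|t v c w d vc wd]; first by right; exact: lG.1.
    have [X [lX Xv Xw XF]] := key _ _ vc wd.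
    by apply: XF; exact: lX.2.
  - move=> [[X FX Xv]|Gv]; last exact: dG.
    by have [_ _ dX] := FP _ FX; apply: dX; left.
pose H := A `|` G.
have Htot v0 : exists c, H (v0, c).
  apply: contrapT => nH.
  have [a da] := hahn_banach_step v0 lA dA.
  pose B := [set vc : V * R | exists w c t, H (w, c) /\
    vc = (w + r2K t *: v0, c + t * a)].
  have HB : H `<=` B.
    move=> [w c] Hw; exists w, c, 0; split=> //.
    by rewrite scal_of_real0 scale0r mul0r !addr0.
  have BG : B `|` G = B by apply: setUidl => x Gx; apply: HB; right.
  apply: (maxA B); last first.
    split; first by left.
      rewrite BG; split; first by apply: HB; exact: lA.1.
      move=> t _ _ _ _ [w [c [s [Hw [-> ->]]]]] [w' [c' [s' [Hw' [-> ->]]]]].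
      exists (r2K t *: w + w'), (t * c + c'), (t * s + s'); split; first exact: lA.2.
      congr pair.
        by rewrite scal_of_realD scal_of_realM scalerDl scalerDr -scalerA addrACA.
      by ring.
    by rewrite BG.
  split=> [|BA]; first by move=> x Ax; apply: HB; left.
  apply: nH; exists a; left; apply: BA; exists 0, 0, 1; split; first exact: lA.1.
  by rewrite scal_of_real1 scale1r mul1r !add0r.
have [g gP] := choice Htot.
have gE v c : H (v, c) -> g v = c by move=> vc; exact: (dominated_functional lA dA (gP v) vc).
exists g; split=> [v w|t v|v|v c Gv].
- by apply: gE; apply: (real_linear_relD lA (gP v) (gP w)).
- by apply: gE; apply: (real_linear_relZ t lA (gP v)).
- exact: (dA _ _ (gP v)).
- by apply: gE; right.
Qed.

End Extension.
End HahnBanach.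

(** * Hahn-Banach over real or complex scalars *)

Section ScalarHahnBanach.
Context {R : realType} {k : scalar_kind}.
Local Notation K := (scalar_field R k).
Local Notation r2K := (@scal_of_real R k).

Lemma scal_reD (x y : K) : scal_re (x + y) = scal_re x + scal_re y.
Proof. by rewrite /scal_re; case: k x y => // -[a b] [c d]. Qed.

Lemma scal_re0 : scal_re (0 : K) = 0.
Proof. by rewrite -(scal_of_real0 (k := k)) scal_re_of_real. Qed.

Lemma scal_reZ t (x : K) : scal_re (r2K t * x) = t * scal_re x.
Proof.
by rewrite /scal_re /scal_of_real; case: k x => // -[a b] /=; rewrite mul0r subr0.
Qed.

Lemma scal_re_le_rnorm (x : K) : scal_re x <= rnorm x.
Proof.
rewrite /rnorm /scal_re; case: k x => [x|[a b]]; first exact: ler_norm.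
rewrite [leRHS]/(Num.sqrt (a ^+ 2 + b ^+ 2)) /=.
by rewrite (le_trans (ler_norm a))// -sqrtr_sqr ler_wsqrtr// lerDl sqr_ge0.
Qed.

Lemma rnorm_scal_of_real t : rnorm (r2K t : K) = `|t|.
Proof.
have [t0|/ltW t0] := leP 0 t; first by rewrite rnorm_of_real// ger0_norm.
have -> : rnorm (r2K t : K) = rnorm (r2K (- t) : K).
  by rewrite scal_of_realN /rnorm normrN.
by rewrite rnorm_of_real ?oppr_ge0// ler0_norm.
Qed.

Lemma rnorm1 : rnorm (1 : K) = 1.
Proof. by rewrite -(scal_of_real1 (k := k)) rnorm_of_real. Qed.

Lemma rnormV (x : K) : rnorm x^-1 = (rnorm x)^-1.
Proof.
have [->|x0] := eqVneq x 0; first by rewrite invr0 rnorm0 invr0.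
have nx0 : rnorm x != 0 by apply: contra_neq x0 => /rnorm_eq0.
by apply: (mulfI nx0); rewrite -rnormM !mulfV// rnorm1.
Qed.

Lemma rnorm_sum (V : normedZmodType K) (I : Type) (s : seq I) (P : pred I) (f : I -> V) :
  rnorm (\sum_(i <- s | P i) f i) <= \sum_(i <- s | P i) rnorm (f i).
Proof.
elim/big_rec2 : _ => [|i y z _ yz]; first by rewrite rnorm0.
by rewrite (le_trans (rnormD _ _))// lerD2l.
Qed.

Lemma phase_exists (z : K) : exists2 l : K, rnorm l = 1 & l * z = r2K (rnorm z).
Proof.
have [->|z0] := eqVneq z 0; first by exists 1; rewrite ?rnorm1// rnorm0 mulr0 scal_of_real0.
have nz0 : rnorm z != 0 by apply: contra_neq z0 => /rnorm_eq0.
exists (r2K (rnorm z) / z); last by rewrite mulfVK.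
by rewrite rnormM rnormV rnorm_of_real ?rnorm_ge0// mulfV.
Qed.

Theorem hahn_banach (V : lmodType K) (q : V -> R) (G : set (V * K)) :
  (forall v w, q (v + w) <= q v + q w) ->
  (forall l v, q (l *: v) = rnorm l * q v) ->
  G (0, 0) ->
  (forall l v c w d, G (v, c) -> G (w, d) -> G (l *: v + w, l * c + d)) ->
  (forall v c, G (v, c) -> rnorm c <= q v) ->
  exists g : V -> K, [/\ forall l v w, g (l *: v + w) = l * g v + g w,
    forall v, rnorm (g v) <= q v & forall v c, G (v, c) -> g v = c].
Proof.
move=> qD qZ G0 GD Gq.
pose H := [set vr : V * R | exists2 c, G (vr.1, c) & vr.2 = scal_re c].
have qsub : real_sublinear q.
  by split=> // t v t0; rewrite qZ rnorm_of_real// ltW.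
have lH : real_linear_rel H.
  split; first by exists 0 => //=; rewrite -(scal_of_real0 (k := k)) scal_re_of_real.
  move=> t v _ w _ [c /= vc ->] [d /= wd ->].
  by exists (r2K t * c + d); [exact: GD|rewrite scal_reD scal_reZ].
have dH : dominated q H.
  by move=> v _ [c /= vc ->]; rewrite (le_trans (scal_re_le_rnorm _))// Gq.
have [f [fD fZ fq fG]] := hahn_banach_real qsub lH dH.
suff [g gl [gre gG]] : exists2 g : V -> K,
    forall l v w, g (l *: v + w) = l * g v + g w &
    (forall v, scal_re (g v) = f v) /\ forall v c, G (v, c) -> g v = c.
  exists g; split=> // v.
  (* A rotation makes the value at [v] real and nonnegative, so the bound on the real part bounds
     the modulus. *)
  have [l l1 lg] := phase_exists (g v).
  have g0 : g 0 = 0.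
    have := gl 1 0 0; rewrite scaler0 addr0 mul1r => /eqP.
    by rewrite -subr_eq subrr eq_sym => /eqP.
  have glv : g (l *: v) = r2K (rnorm (g v)).
    by have := gl l v 0; rewrite addr0 g0 addr0 lg.
  rewrite -(scal_re_of_real (k := k) (rnorm (g v))) -glv gre (le_trans (fq _))//.
  by rewrite qZ l1 mul1r.
have {}fG v c : G (v, c) -> f v = scal_re c by move=> vc; apply: fG; exists c.
have GZ l v c : G (v, c) -> G (l *: v, l * c).
  by move=> vc; have := GD l _ _ _ _ vc G0; rewrite !addr0.
clear qsub lH dH H fq Gq GD G0 qD qZ q.
move: fD fZ fG GZ; rewrite /scal_re /scal_of_real; case: k V G f.
  move=> V G f fD fZ fG _; exists f; last by split.
  by move=> l v w; rewrite fD fZ.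
move=> V G f fD fZ fG GZ.
pose j : R[i] := (0 +i* 1)%C.
(* A complex-linear functional is recovered from its real part by g(v) = f(v) - i f(iv). *)
exists (fun v => (f v +i* - f (j *: v))%C : scalar_field R ComplexScalars).
  have gD v w : (f (v + w) +i* - f (j *: (v + w)))%C =
      (f v +i* - f (j *: v))%C + (f w +i* - f (j *: w))%C.
    by rewrite scalerDr !fD opprD.
  move=> l v w; rewrite gD; congr (_ + _).
  case: l => a b.
  have -> : (a +i* b)%C *: v = ((a +i* 0)%C : scalar_field R ComplexScalars) *: v
    + ((b +i* 0)%C : scalar_field R ComplexScalars) *: (j *: v).
    rewrite scalerA -scalerDl; congr (_ *: v).
    by apply/eqP; rewrite eq_complex /=; apply/andP; split; apply/eqP; ring.
  have ZC (x y : R[i]) (u : V) : (x : scalar_field R ComplexScalars) *: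
      ((y : scalar_field R ComplexScalars) *: u) =
      (y : scalar_field R ComplexScalars) *: ((x : scalar_field R ComplexScalars) *: u).
    by rewrite !scalerA mulrC.
  rewrite scalerDr ![j *: (_ *: _)]ZC [j *: (j *: v)]scalerA.
  have -> : j * j = -1.
    by apply/eqP; rewrite eq_complex /=; apply/andP; split; apply/eqP; ring.
  rewrite scaleN1r !fD !fZ.
  have fN u : f (- u) = - f u.
    have f0 : f 0 = 0 by have := fZ 0 0; rewrite scaler0 mul0r.
    by apply/eqP; rewrite -addr_eq0 -fD addNr f0.
  rewrite fN; apply/eqP; rewrite eq_complex /=; apply/andP; split; apply/eqP; ring.
split=> // v [a b] vc; apply/eqP; rewrite eq_complex /=.
rewrite (fG _ _ vc) (fG _ _ (GZ j _ _ vc)) /=.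
by rewrite mul0r mul1r sub0r opprK !eqxx.
Qed.

End ScalarHahnBanach.

(** * Riesz-Markov theorem *)

Section BoundedFunctions.
Context {R : realType}.

Definition bounded_fct (U : Type) (f : U -> R) := exists M, forall x, `|f x| <= M.

Context {T : Type}.
Implicit Types f g : T -> R.

Lemma bounded_fctD f g : bounded_fct f -> bounded_fct g ->
  bounded_fct (fun x => f x + g x).
Proof.
move=> [M fM] [N gN]; exists (M + N) => x.
by rewrite (le_trans (ler_normD _ _))// lerD.
Qed.

Lemma bounded_fctZ t f : bounded_fct f -> bounded_fct (fun x => t * f x).
Proof. by move=> [M fM]; exists (`|t| * M) => x; rewrite normrM ler_wpM2l. Qed.

Lemma bounded_cst c : bounded_fct (fun _ : T => c).
Proof. by exists `|c|. Qed.

Lemma bounded_indic (A : set T) : bounded_fct (\1_A : T -> R).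
Proof. by exists 1 => x; rewrite indicE ger0_norm//; case: (_ \in _). Qed.

Lemma bounded_sum n (f : nat -> T -> R) : (forall i, bounded_fct (f i)) ->
  bounded_fct (fun x => \sum_(i < n) f i x).
Proof.
move=> bf; elim: n => [|n IH].
  by exists 0 => x; rewrite big_ord0 normr0.
under [X in bounded_fct X]eq_fun do rewrite big_ord_recr/=.
exact: bounded_fctD.
Qed.

End BoundedFunctions.

Section BoundedIntegral.
Context {R : realType} {d : measure_display} {T : measurableType d}.
Variable m : {finite_measure set T -> \bar R}.
Implicit Types f g : T -> R.

Lemma bounded_integrable f : measurable_fun setT f -> bounded_fct f ->
  m.-integrable setT (EFin \o f).
Proof.
move=> mf [M fM]; apply: measurable_bounded_integrable => //.
  by rewrite -ge0_fin_numE// fin_num_measure.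
exists M; split; first exact: num_real.
by move=> N MN x _ /=; rewrite (le_trans (fM x))// ltW.
Qed.

Lemma Rintegral_sum n (f : nat -> T -> R) :
  (forall i, measurable_fun setT (f i)) -> (forall i, bounded_fct (f i)) ->
  \int[m]_x (\sum_(i < n) f i x) = \sum_(i < n) \int[m]_x f i x.
Proof.
move=> mf bf; elim: n => [|n IH].
  under eq_Rintegral do rewrite big_ord0.
  by rewrite big_ord0 Rintegral_cst// mul0r.
rewrite big_ord_recr/= -IH -RintegralD//; last 2 first.
- apply: bounded_integrable; last exact: bounded_sum.
  by under eq_fun do rewrite -(big_mkord xpredT (fun i => f i _)); exact: measurable_sum.
- exact: bounded_integrable.
by apply: eq_Rintegral => x _; rewrite big_ord_recr.
Qed.

End BoundedIntegral.

Lemma continuous_borel_measurable {R : realType} (T : ptopologicalType) (f : T -> R) :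
  continuous f -> measurable_fun setT (f : borel T -> R).
Proof.
move=> cf; apply: (measurability _ (RGenOpens.measurableE R)).
move=> _ [_ [a [b ->] <-]]; rewrite setTI.
apply: sub_sigma_algebra; apply: open_comp; last exact: interval_open.
by move=> x _; exact: cf.
Qed.

Lemma continuous_bounded_fct {R : realType} (T : ptopologicalType) (f : T -> R) :
  compact [set: T] -> continuous f -> bounded_fct f.
Proof.
move=> cT cf; have : compact (f @` setT).
  by apply: continuous_compact => //; exact: continuous_subspaceT.
move=> /compact_bounded[M [_ fM]]; exists (M + 1) => x.
by apply: (fM (M + 1)); [rewrite ltrDl|exists x].
Qed.

(** A discrete layer-cake formula: this bound from above counts the levels below [y] from 0, while
    the bound from below in [sum_levels_le] counts them from 1. *)
Lemma le_sum_levels {R : realType} (y : R) N : 0 <= y <= N%:R ->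
  y <= \sum_(i < N) (i%:R < y)%R%:R.
Proof.
elim: N => [|N IH] /andP[y0 yN]; first by rewrite big_ord0.
rewrite big_ord_recr/=; have [Ny|yN'] := ltP N%:R y; last first.
  by rewrite (le_trans (IH _)) ?y0// lerDl.
rewrite (le_trans yN)// -natr1 lerD2r.
rewrite (eq_bigr (fun=> 1)) ?sumr_const ?card_ord// => i _.
by rewrite (le_lt_trans _ Ny)// ler_nat ltnW.
Qed.

Lemma sum_levels_le {R : realType} (y : R) N : 0 <= y ->
  \sum_(i < N) (i.+1%:R < y)%R%:R <= y.
Proof.
move=> y0; elim: N => [|N IH]; first by rewrite big_ord0.
rewrite big_ord_recr/=; have [Ny|_] := ltP N.+1%:R y; last by rewrite addr0.
rewrite (le_trans _ (ltW Ny))// -natr1 lerD2r.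
rewrite (@le_trans _ _ (\sum_(i < N) 1))//; last by rewrite sumr_const card_ord.
by apply: ler_sum => i _; case: ltP.
Qed.

(** * The regular measure of a positive functional on a compact Hausdorff space *)

Section RieszMarkov.
Context {R : realType} {T : ptopologicalType}.
Hypotheses (hausT : hausdorff_space T) (cptT : compact [set: T]).

Variable L : (T -> R) -> R.
Hypothesis LD : forall f g, bounded_fct f -> bounded_fct g ->
  L (fun x => f x + g x) = L f + L g.
Hypothesis LZ : forall t f, bounded_fct f -> L (fun x => t * f x) = t * L f.
Hypothesis L_ge0 : forall f, bounded_fct f -> (forall x, 0 <= f x) -> 0 <= L f.

Lemma L_le f g : bounded_fct f -> bounded_fct g -> (forall x, f x <= g x) ->
  L f <= L g.
Proof.
move=> bf bg fg; rewrite -subr_ge0 addrC -mulN1r -LZ// -LD//; last exact: bounded_fctZ.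
apply: L_ge0 => [|x]; first by apply: bounded_fctD => //; exact: bounded_fctZ.
by rewrite mulN1r addrC subr_ge0.
Qed.

Lemma L_sum n (f : nat -> T -> R) : (forall i, bounded_fct (f i)) ->
  L (fun x => \sum_(i < n) f i x) = \sum_(i < n) L (f i).
Proof.
move=> bf; elim: n => [|n IH].
  rewrite big_ord0 -[RHS](mul0r (L (fun=> 0))) -LZ; last exact: bounded_cst.
  by congr L; apply/funext => x; rewrite big_ord0 mul0r.
rewrite big_ord_recr/= -IH -LD//; last exact: bounded_sum.
by congr L; apply/funext => x; rewrite big_ord_recr.
Qed.

Let nu (A : set T) : R := L \1_A.

Let nu_ge0 A : 0 <= nu A.
Proof. by apply: L_ge0 => [|x]; [exact: bounded_indic|rewrite indicE]. Qed.

Let nu0 : nu set0 = 0.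
Proof.
rewrite -[RHS](mul0r (nu set0)) -LZ; last exact: bounded_indic.
by congr L; apply/funext => x; rewrite indicE in_set0 mul0r.
Qed.

Let nu_sub A B : A `<=` B -> nu A <= nu B.
Proof.
move=> AB; apply: L_le => [||x]; [exact: bounded_indic..|].
rewrite !indicE; have [Ax|_] := boolP (x \in A); last exact: ler0n.
by rewrite (mem_set (AB _ (set_mem Ax))).
Qed.

Let nuU A B C : C `<=` A `|` B -> nu C <= nu A + nu B.
Proof.
move=> CAB; rewrite -LD; [|exact: bounded_indic..].
apply: L_le => [||x]; [exact: bounded_indic|by apply: bounded_fctD; exact: bounded_indic|].
rewrite !indicE; have [Cx|] := boolP (x \in C); last by rewrite addr_ge0.
have [/mem_set ->|/mem_set ->] := CAB _ (set_mem Cx).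
  by rewrite lerDl.
by rewrite lerDr.
Qed.

Let nuDI A B : A `&` B = set0 -> nu A + nu B <= nu (A `|` B).
Proof.
move=> AB; rewrite -LD; [|exact: bounded_indic..].
apply: L_le => [||x]; [by apply: bounded_fctD; exact: bounded_indic|exact: bounded_indic|].
rewrite !indicE in_setU; have [Ax|_] := boolP (x \in A); last by rewrite add0r.
have [Bx|_] := boolP (x \in B); last by rewrite addr0.
suff : (A `&` B) x by rewrite AB.
by split; exact: set_mem.
Qed.

(* [nu] is only finitely additive; [inner_content] and [riesz_outer] regularize it.
   As [L] is defined on all bounded functions, no Urysohn function is needed. *)
Definition inner_content (U : set T) : \bar R :=
  ereal_sup [set (nu C)%:E | C in [set C | closed C /\ C `<=` U]].
Local Notation lam := inner_content.

Definition riesz_outer (A : set T) : \bar R :=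
  ereal_inf [set lam U | U in [set U | open U /\ A `<=` U]].
Local Notation mu := riesz_outer.

Local Open Scope ereal_scope.

Let lam_ge0 U : 0 <= lam U.
Proof.
apply: (@le_trans _ _ (nu set0)%:E); first by rewrite lee_fin.
by apply: ereal_sup_ubound; exists set0 => //; split=> //; exact: closed0.
Qed.

Let lam_sub U V : U `<=` V -> lam U <= lam V.
Proof.
move=> UV; apply: le_ereal_sup => _ [C [cC CU] <-].
by exists C => //; split=> //; exact: subset_trans UV.
Qed.

Let le_lam C U : closed C -> C `<=` U -> (nu C)%:E <= lam U.
Proof. by move=> cC CU; apply: ereal_sup_ubound; exists C. Qed.

Let lam_le_nu U : lam U <= (nu U)%:E.
Proof. by apply: ge_ereal_sup => _ [C [cC CU] <-]; rewrite lee_fin nu_sub. Qed.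

Let mu_open U : open U -> mu U = lam U.
Proof.
move=> oU; apply/eqP; rewrite eq_le; apply/andP; split.
  by apply: ereal_inf_lbound; exists U => //; split.
by apply: le_ereal_inf_tmp => _ [V [oV UV] <-]; exact: lam_sub.
Qed.

Let mu_ge0 A : 0 <= mu A.
Proof. by apply: le_ereal_inf_tmp => _ [V _ <-]; exact: lam_ge0. Qed.

Let mu_sub : {homo mu : A B / A `<=` B >-> A <= B}.
Proof.
move=> A B AB; apply: le_ereal_inf => _ [V [oV BV] <-].
by exists V => //; split=> //; exact: subset_trans BV.
Qed.

Let lam_fin U : lam U \is a fin_num.
Proof. by rewrite ge0_fin_numE// (le_lt_trans (lam_le_nu U))// ltry. Qed.

Let mu_fin A : mu A \is a fin_num.
Proof.
rewrite ge0_fin_numE// (le_lt_trans (mu_sub (@subsetT _ A)))//.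
by rewrite mu_open; [rewrite -ge0_fin_numE|exact: openT].
Qed.

(** Induction peels off the last open set. By normality, the part of [C] outside the other sets has
    a neighbourhood [B] whose closure lies in the last one; [C] is then covered by two closed
    pieces, one inside the union [V] of the others and one inside the last set. *)
Let lam_cover n (U : nat -> set T) C : (forall i, open (U i)) -> closed C ->
  C `<=` \big[setU/set0]_(i < n) U i -> (nu C)%:E <= \sum_(i < n) lam (U i).
Proof.
move=> oU; elim: n C => [C cC|n IH C cC].
  by rewrite !big_ord0 => C0; rewrite lee_fin -nu0 nu_sub.
rewrite !big_ord_recr/=; set V := \big[_/_]_(_ < _) _ => CVU.
have oV : open V by rewrite /V -bigcup_mkord; exact: bigcup_open.
have cCV : closed (C `\` V) by apply: closedI => //; exact: open_closedC.
have CVUn : C `\` V `<=` U n by move=> x [Cx nVx]; have [|] := CVU _ Cx.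
have [B /set_nbhsP[W [oW CVW WB]] BU] : filter_from (set_nbhs (C `\` V)) closure (U n).
  apply: (compact_normal hausT cptT) => //.
  by apply/set_nbhsP; exists (U n); split.
have C1 : closed (C `&` closure B) by apply: closedI => //; exact: closed_closure.
have C2 : closed (C `\` W) by apply: closedI => //; exact: open_closedC.
apply: (@le_trans _ _ ((nu (C `\` W))%:E + (nu (C `&` closure B))%:E)).
  rewrite -EFinD lee_fin; apply: nuU => x Cx.
  have [Wx|nWx] := pselect (W x); last by left.
  by right; split=> //; apply: subset_closure; exact: WB.
apply: leeD; last by apply: le_lam => // x [_ /BU].
apply: IH => // x [Cx nWx]; apply: contrapT => nVx.
by apply: nWx; apply: CVW.
Qed.

Let lam_bigcup (U : nat -> set T) : (forall i, open (U i)) ->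
  lam (\bigcup_i U i) <= \sum_(i <oo) lam (U i).
Proof.
move=> oU; apply: ge_ereal_sup => _ [C [cC CU] <-].
(* Compactness of the closed set cuts the countable cover down to a finite one. *)
have : compact C by apply: subclosed_compact cC cptT _.
rewrite compact_cover => /(_ nat setT U (fun i _ => oU i)) [x /CU//|D _ CD].
have [n Dn] : exists n, forall i, i \in D -> (i < n)%N.
  exists (\max_(i <- enum_fset D) i).+1 => i iD.
  by rewrite ltnS; exact: (@leq_bigmax_seq _ _ xpredT id i).
have : C `<=` \big[setU/set0]_(i < n) U i.
  move=> x /CD[i /= iD Uix]; rewrite -bigcup_mkord; exists i => //=; exact: Dn.
move=> /(lam_cover oU cC)/le_trans; apply.
rewrite -(big_mkord xpredT (fun i => lam (U i))).
exact: nneseries_lim_ge.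
Qed.

Let mu0 : mu set0 = 0.
Proof.
apply/eqP; rewrite eq_le mu_ge0 andbT mu_open; last exact: open0.
by rewrite (le_trans (lam_le_nu _))// nu0.
Qed.

Let mu_approx A (e : R) : (0 < e)%R -> exists U, [/\ open U, A `<=` U & lam U <= mu A + e%:E].
Proof.
move=> e0; have [|_ [U [oU AU] <-] Ue] := @lb_ereal_inf_adherent _
  [set lam U | U in [set U | open U /\ A `<=` U]] e e0; first exact: mu_fin.
by exists U; split=> //; exact: ltW.
Qed.

Let mu_sigma_subadditive : sigma_subadditive mu.
Proof.
move=> F; apply/lee_addgt0Pr => e e0.
have e2 n : (0 < e / (2 ^ n.+1)%:R)%R by rewrite divr_gt0// ltr0n expn_gt0.
have [U UP] := choice (fun n => mu_approx (F n) (e2 n)).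
have oU n : open (U n) by have [] := UP n.
apply: (@le_trans _ _ (lam (\bigcup_n U n))).
  rewrite -mu_open; last exact: bigcup_open.
  by apply: mu_sub; apply: subset_bigcup => n _; have [] := UP n.
apply: (le_trans (lam_bigcup oU)).
apply: le_trans (epsilon_trick xpredT _ (ltW e0)); last by move=> n; exact: mu_ge0.
by apply: lee_nneseries => n _ => [_|]; [exact: lam_ge0|have [] := UP n].
Qed.

HB.instance Definition _ := isOuterMeasure.Build R T mu
  mu0 mu_ge0 mu_sub mu_sigma_subadditive.

(** It suffices to split an open [V] nearly optimal for [X]. A closed [C] inside both [V] and [U],
    and then a closed [D] inside [V] minus [C], are disjoint, so nu(C) + nu(D) is at most the
    content of [V]; taking suprema over [D] and then over [C] gives the inequality. *)
Let open_caratheodory U : open U -> mu.-caratheodory U.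
Proof.
move=> oU; apply: le_caratheodory_measurable => X.
apply/lee_addgt0Pr => e e0.
have [V [oV XV Ve]] := mu_approx X e0.
apply: le_trans Ve.
apply: (@le_trans _ _ (mu (V `&` U) + mu (V `&` ~` U))).
  by apply: leeD; apply: mu_sub; exact: setSI.
have oVU : open (V `&` U) by exact: openI.
rewrite (mu_open oVU) -leeBrDr//.
apply: ge_ereal_sup => _ [C [cC CVU] <-].
have oVC : open (V `\` C) by apply: openI => //; exact: closed_openC.
rewrite leeBrDr// (@le_trans _ _ ((nu C)%:E + lam (V `\` C)))//.
  rewrite leeD2l// -mu_open//; apply: mu_sub => x [Vx nUx]; split=> //.
  by move=> /CVU[].
rewrite -leeBrDl//; apply: ge_ereal_sup => _ [D [cD DVC] <-].
rewrite leeBrDl// -EFinD.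
apply: (@le_trans _ _ (nu (C `|` D))%:E).
  rewrite lee_fin; apply: nuDI; rewrite -subset0 => x [Cx Dx].
  by have [] := DVC _ Dx.
apply: le_lam; first exact: closedU.
by move=> x [/CVU[]//|/DVC[]].
Qed.

Let borel_caratheodory (A : set (borel T)) : measurable A -> mu.-caratheodory A.
Proof.
have sub : [set A | open A] `<=` mu.-cara.-measurable.
  by move=> U /open_caratheodory.
apply: (smallest_sub _ sub); exact: sigma_algebra_measurable.
Qed.

Definition riesz_measure (A : set (borel T)) : \bar R := mu A.

Let riesz_measure_sigma_additive : semi_sigma_additive riesz_measure.
Proof.
move=> F mF tF mUF.
have := @caratheodory_measure_sigma_additive _ _ mu F.
by apply=> // [i|]; exact: borel_caratheodory.
Qed.

HB.instance Definition _ := isMeasure.Build _ _ _ riesz_measure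
  mu0 mu_ge0 riesz_measure_sigma_additive.

Let riesz_measure_finite : fin_num_fun riesz_measure.
Proof. by move=> A _; exact: mu_fin. Qed.

HB.instance Definition _ := @Measure_isFinite.Build _ _ _
  riesz_measure riesz_measure_finite.

(** The mass survives the regularization because the whole space is both open and closed. *)
Let mT : mu setT = (L (fun=> 1%R))%:E.
Proof.
have L1 : L (fun=> 1%R) = nu setT by congr L; apply/funext => x; rewrite indicT.
rewrite mu_open; last exact: openT.
by apply/eqP; rewrite eq_le L1 lam_le_nu le_lam//; exact: closedT.
Qed.

(** Open sets [U] around [A] and [V] around its complement are taken with excess at most e/2. The
    compact set is the complement of [V], and what [U] has beyond it is its intersection with [V].
    Splitting the space along [A] and along [V], and [U] along [V], leaves linear arithmetic. *)
Let riesz_regular (A : set (borel T)) (e : R) : measurable A -> (0 < e)%R ->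
  exists (C U : set T), [/\ compact C, open U, C `<=` A, A `<=` U &
    mu (U `\` C) <= e%:E].
Proof.
move=> /borel_caratheodory cA e0.
have e2 : (0 < e / 2)%R by rewrite divr_gt0.
have [U [oU AU Ue]] := mu_approx A e2.
have [V [oV AV Ve]] := mu_approx (~` A) e2.
have cV : closed (~` V) by exact: open_closedC.
exists (~` V), U; split=> //; first exact: subclosed_compact cV cptT _.
  by move=> x nVx; apply: contrapT => nAx; apply: nVx; exact: AV.
rewrite setDE setCK.
have := cA setT; rewrite !setTI.
have := open_caratheodory oV U.
have := open_caratheodory oV setT; rewrite !setTI.
have -> : U `&` ~` V = ~` V.
  apply/seteqP; split=> [x []//|x nVx]; split=> //.
  by apply: AU; apply: contrapT => nAx; apply: nVx; exact: AV.
rewrite -mu_open// in Ue; rewrite -mu_open// in Ve.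
move: Ue Ve.
rewrite -[mu U]fineK// -[mu V]fineK// -[mu A]fineK// -[mu (~` A)]fineK//.
rewrite -[mu (U `&` V)]fineK// -[mu (~` V)]fineK// -[mu setT]fineK//.
rewrite -!EFinD !lee_fin => Ue Ve [TV] [UV] [TA].
by lra.
Qed.

Local Close Scope ereal_scope.

Let open_level (f : T -> R) (a : R) : continuous f -> open [set x | a < f x].
Proof.
move=> cf; apply: (@open_comp _ _ f [set y | a < y]) => [x _|]; first exact: cf.
exact: open_gt.
Qed.

(** [nu] is below the content only through closed sets; the gap between [a] and [b] leaves room for
    the closed set where f >= b. *)
Let nu_level (f : T -> R) (a b : R) : continuous f -> a < b ->
  nu [set x | b < f x] <= fine (riesz_measure [set x | a < f x]).
Proof.
move=> cf ab; rewrite -lee_fin fineK//.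
have oa : open [set x | a < f x] by exact: open_level.
have cb : closed [set x | b <= f x].
  by apply: (@closed_comp _ _ f [set y | b <= y]) => [x _|]; [exact: cf|exact: closed_ge].
rewrite /riesz_measure (mu_open oa).
apply: (@le_trans _ _ (nu [set x | b <= f x])%:E).
  by rewrite lee_fin; apply: nu_sub => x /ltW.
by apply: le_lam => // x; exact: lt_le_trans.
Qed.

(* The error term does not depend on f: it disappears when f is replaced by n * f. *)
Let L_le_integral (f : T -> R) : continuous f -> (forall x, 0 <= f x) ->
  L f <= nu setT *+ 2 + \int[riesz_measure]_x f x.
Proof.
move=> cf f0.
have mf := continuous_borel_measurable cf.
have bf := continuous_bounded_fct cptT cf.
have [N fN] : exists N, forall x, f x <= N.+2%:R.
  have [M fM] := bf; exists (Num.truncn `|M|) => x.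
  rewrite (le_trans (ler_norm _))// (le_trans (fM x))// (le_trans (ler_norm M))//.
  by rewrite ltW// (lt_trans (truncnS_gt _))// ltr_nat.
pose A (i : nat) := [set x | i%:R < f x].
have Ax i x : \1_(A i) x = (i%:R < f x)%R%:R :> R.
  rewrite indicE; congr (nat_of_bool _)%:R.
  by apply/idP/idP => [/set_mem|ifx]; last exact/mem_set.
have mA i : measurable (A i : set (borel T)).
  by apply: sub_sigma_algebra; exact: open_level.
have bA i : bounded_fct (\1_(A i) : T -> R) by exact: bounded_indic.
apply: (@le_trans _ _ (\sum_(i < N.+2) nu (A i))).
  rewrite -(@L_sum N.+2 (fun i => \1_(A i)))//; apply: L_le => // [|x].
    exact: (@bounded_sum _ _ N.+2 (fun i => \1_(A i))).
  by under eq_bigr do rewrite Ax; rewrite le_sum_levels// f0 fN.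
(* The two lowest levels are given up, each at a cost of at most nu(T): one pays for the shift in
   [nu_level], the other for the sum below [f] starting at level 1. *)
rewrite 2!big_ord_recl addrA lerD//; first by rewrite mulr2n lerD// nu_sub.
apply: (@le_trans _ _ (\sum_(i < N) \int[riesz_measure]_x \1_(A i.+1) x)).
  apply: ler_sum => i _; rewrite /Rintegral integral_indic// setIT.
  by apply: nu_level => //; rewrite ltr_nat.
rewrite -(@Rintegral_sum _ _ _ riesz_measure N (fun i => \1_(A i.+1) : T -> R))
  => [|i|i//]; last first.
  exact: measurable_indic.
apply: le_Rintegral => // [||x _]; [|exact: bounded_integrable|].
  apply: bounded_integrable; last by apply: (@bounded_sum _ _ N (fun i => \1_(A i.+1))).
  under eq_fun do rewrite -(big_mkord xpredT (fun i => \1_(A i.+1) _)).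
  by apply: measurable_sum => i; exact: measurable_indic.
by under eq_bigr do rewrite Ax; exact: sum_levels_le.
Qed.

(** Scaling removes the error term and gives L(g) <= integral of g for g >= 0. As both sides agree
    on constants, this inequality for M + f and for M - f yields the equality. *)
Let integral_riesz (f : T -> R) : continuous f -> \int[riesz_measure]_x f x = L f.
Proof.
move=> cf.
have I (g : T -> R) : continuous g -> riesz_measure.-integrable setT (EFin \o g).
  move=> cg; apply: bounded_integrable; first exact: continuous_borel_measurable.
  exact: continuous_bounded_fct.
have ge0 (g : T -> R) : continuous g -> (forall x, 0 <= g x) ->
    L g <= \int[riesz_measure]_x g x.
  move=> cg g0; rewrite leNgt; apply/negP; rewrite -subr_gt0 => Lg.
  set e := L g - _ in Lg.
  (* This choice makes n * e exceed the error term 2 nu(T). *)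
  pose n := (Num.truncn (nu setT *+ 2 / e)).+1.
  have cng : continuous (fun x => n%:R * g x).
    by move=> x; apply: cvgM; [exact: cvg_cst|exact: cg].
  have := L_le_integral cng (fun x => mulr_ge0 (ler0n _ _) (g0 x)).
  rewrite LZ; last exact: continuous_bounded_fct.
  rewrite RintegralZl//; last exact: I.
  rewrite -lerBlDr -mulrBr -/e; apply/negP; rewrite -ltNge.
  by rewrite -ltr_pdivrMr// truncnS_gt.
have bf := continuous_bounded_fct cptT cf; have [M fM] := bf.
have bM : bounded_fct (fun _ : T => M) by exact: bounded_cst.
have L1 : \int[riesz_measure]_x M = L (fun=> M).
  rewrite Rintegral_cst// -[LHS]/(M * fine (mu setT)) mT/= -LZ; last exact: bounded_cst.
  by congr L; apply/funext => x; rewrite mulr1.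
have cM : continuous (fun _ : T => M) by move=> x; exact: cvg_cst.
apply/eqP; rewrite eq_le; apply/andP; split.
- have cMf : continuous (fun x => M + -1 * f x).
    move=> x; apply: cvgD; first exact: cvg_cst.
    by apply: cvgM; [exact: cvg_cst|exact: cf].
  have := ge0 _ cMf; rewrite RintegralD//; last 2 first.
  + exact: I.
  + by apply: I => x; apply: cvgM; [exact: cvg_cst|exact: cf].
  rewrite RintegralZl//; last exact: I.
  rewrite LD ?LZ ?L1//; last exact: bounded_fctZ.
  move=> H; have : forall x, 0 <= M + -1 * f x.
    by move=> x; rewrite mulN1r subr_ge0 (le_trans (ler_norm _)).
  by move=> /H; rewrite !mulN1r lerD2l lerN2.
- have cMf : continuous (fun x => M + f x).
    by move=> x; apply: cvgD; [exact: cvg_cst|exact: cf].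
  have := ge0 _ cMf; rewrite RintegralD//; [|exact: I..].
  rewrite LD ?L1//.
  move=> H; have : forall x, 0 <= M + f x.
    by move=> x; rewrite -lerBlDl sub0r lerNl (le_trans (ler_norm _))// normrN.
  by move=> /H; rewrite lerD2l.
Qed.

Theorem riesz_markov : exists m : {finite_measure set (borel T) -> \bar R},
  [/\ m setT = (L (fun=> 1))%:E,
    forall (A : set (borel T)) (e : R), measurable A -> 0 < e ->
      exists (C U : set T), [/\ compact C, open U, C `<=` A, A `<=` U &
        (m (U `\` C) <= e%:E)%E] &
    forall f : T -> R, continuous f -> \int[m]_x f x = L f].
Proof.
exists riesz_measure; split; [exact: mT|exact: riesz_regular|exact: integral_riesz].
Qed.

End RieszMarkov.

(** * Integration against charges and scalar measures *)

Section ChargeIntegral.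
Context {R : realType} {d : measure_display} {T : measurableType d}.
Implicit Types (nu : {charge set T -> \bar R}) (f g : T -> R).

Definition bounded_measurable f := measurable_fun setT f /\ bounded_fct f.

Lemma bounded_measurableD f g : bounded_measurable f -> bounded_measurable g ->
  bounded_measurable (fun x => f x + g x).
Proof.
by move=> [mf bf] [mg bg]; split; [exact: measurable_funD|exact: bounded_fctD].
Qed.

Lemma bounded_measurableZ t f : bounded_measurable f ->
  bounded_measurable (fun x => t * f x).
Proof.
by move=> [mf bf]; split; [exact: measurable_funM|exact: bounded_fctZ].
Qed.

Lemma charge_integralD nu f g : bounded_measurable f -> bounded_measurable g ->
  charge_integral nu (fun x => f x + g x) = charge_integral nu f + charge_integral nu g.
Proof.
move=> [mf bf] [mg bg]; rewrite /charge_integral.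
by rewrite !RintegralD//; [rewrite opprD addrACA|exact: bounded_integrable..].
Qed.

Lemma charge_integralZ nu t f : bounded_measurable f ->
  charge_integral nu (fun x => t * f x) = t * charge_integral nu f.
Proof.
move=> [mf bf]; rewrite /charge_integral.
by rewrite !RintegralZl//; [rewrite mulrBr|exact: bounded_integrable..].
Qed.

Lemma charge_integral_bound nu : exists C, 0 <= C /\ forall f M, measurable_fun setT f ->
  (forall x, `|f x| <= M) -> `|charge_integral nu f| <= C * M.
Proof.
pose NP := cid (svalP (cid (Hahn_decomposition nu))).
pose jp := jordan_pos (svalP NP); pose jn := jordan_neg (svalP NP).
exists (fine (jp setT) + fine (jn setT)); split.
  by rewrite addr_ge0// fine_ge0.
move=> f M mf fM.
have key (m : {finite_measure set T -> \bar R}) : `|\int[m]_x f x| <= M * fine (m setT).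
  have bf : bounded_fct f by exists M.
  rewrite (le_trans (le_normr_Rintegral _ (bounded_integrable m mf bf)))//.
  rewrite -Rintegral_cst//; apply: le_Rintegral => //.
  - apply: bounded_integrable; first exact: measurableT_comp.
    by exists M => x; rewrite normr_id.
  - by apply: bounded_integrable => //; exact: bounded_cst.
rewrite mulrC mulrDr (le_trans (ler_normB _ _))// lerD//; exact: key.
Qed.

Lemma charge_integral_indic nu (A : set T) : measurable A ->
  charge_integral nu \1_A = fine (nu A).
Proof.
move=> mA; rewrite /charge_integral /Rintegral !integral_indic// setIT.
rewrite [in RHS](jordan_decomp (svalP (cid (svalP (cid (Hahn_decomposition nu))))) mA).
by rewrite /cadd/= cscaleN1/= fineB ?fin_num_measure.
Qed.

(** Whichever Hahn decomposition was chosen, its negative set is null for a positive measure, so the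
    negative Jordan part vanishes. *)
Lemma charge_integral_measure (m : {finite_measure set T -> \bar R}) f :
  charge_integral (charge_of_finite_measure m) f = \int[m]_x f x.
Proof.
rewrite /charge_integral; case: (cid _) => P ?; case: (cid _) => N /= PN.
have [_ negN _ _] := PN; have mN : measurable N by case: negN.
have jn0 A : measurable A -> jordan_neg PN A = 0%E.
  move=> mA; rewrite jordan_negE cjordan_negE /crestr0 mem_set// /crestr.
  have [_ /(_ (A `&` N) (measurableI _ _ mA mN) (@subIsetr _ _ _)) AN0] := negN.
  by apply/eqP; rewrite oppe_eq0 eq_le AN0 measure_ge0.
have jpE A : measurable A -> jordan_pos PN A = m A.
  move=> mA; have := jordan_decomp PN mA.
  by rewrite /cadd/= cscaleN1/= jn0// oppe0 adde0 => <-.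
rewrite /Rintegral (eq_measure_integral m) => [|A mA _]; last exact: jpE.
rewrite [X in _ - fine X](eq_measure_integral mzero) => [|A mA _]; last exact: jn0.
by rewrite integral_measure_zero subr0.
Qed.

End ChargeIntegral.

Section ScalarParts.
Context {R : realType} {k : scalar_kind}.
Local Notation K := (scalar_field R k).
Local Notation r2K := (@scal_of_real R k).

Definition scal_im : K -> R :=
  match k return scalar_field R k -> R with
  | RealScalars => fun=> 0
  | ComplexScalars => fun z => complex.Im z
  end.

Lemma scal_imD (x y : K) : scal_im (x + y) = scal_im x + scal_im y.
Proof. by rewrite /scal_im; case: k x y => [x y|[a b] [c d]] //=; rewrite addr0. Qed.

Lemma scal_reB (x y : K) : scal_re (x - y) = scal_re x - scal_re y.
Proof. by apply/eqP; rewrite eq_sym subr_eq -scal_reD subrK. Qed.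

Lemma scal_imB (x y : K) : scal_im (x - y) = scal_im x - scal_im y.
Proof. by apply/eqP; rewrite eq_sym subr_eq -scal_imD subrK. Qed.

Lemma scal_reM (x y : K) :
  scal_re (x * y) = scal_re x * scal_re y + - scal_im x * scal_im y.
Proof.
rewrite /scal_re /scal_im; case: k x y => [x y|[a b] [c d]] /=; last by rewrite mulNr.
by rewrite mulr0 addr0.
Qed.

Lemma scal_imM (x y : K) :
  scal_im (x * y) = scal_re x * scal_im y + scal_im x * scal_re y.
Proof.
rewrite /scal_re /scal_im; case: k x y => [x y|[a b] [c d]] //=.
by rewrite mulr0 mul0r addr0.
Qed.

Lemma scal_im_of_real t : scal_im (r2K t) = 0.
Proof. by rewrite /scal_im /scal_of_real; case: k. Qed.

Lemma normr_scal_re (z : K) : `|scal_re z| <= rnorm z.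
Proof.
rewrite ler_norml scal_re_le_rnorm andbT lerNl.
have := scal_re_le_rnorm (r2K (-1) * z).
by rewrite scal_reZ mulN1r rnormM rnorm_scal_of_real normrN1 mul1r.
Qed.

Lemma normr_scal_im (z : K) : `|scal_im z| <= rnorm z.
Proof.
rewrite /scal_im /rnorm /scal_re; case: k z => [z|[a b]]; first by rewrite normr0.
rewrite [leRHS]/(Num.sqrt (a ^+ 2 + b ^+ 2)) /=.
by rewrite -sqrtr_sqr ler_wsqrtr// lerDr sqr_ge0.
Qed.

Lemma rnorm_le_parts (z : K) : rnorm z <= `|scal_re z| + `|scal_im z|.
Proof.
rewrite /scal_im /rnorm /scal_re; case: k z => [z|[a b]]; first by rewrite lerDl.
rewrite [leLHS]/(Num.sqrt (a ^+ 2 + b ^+ 2)) /=.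
rewrite -(ler_pXn2r (ltn0Sn 1)) ?nnegrE ?sqrtr_ge0 ?addr_ge0//.
rewrite sqr_sqrtr ?addr_ge0 ?sqr_ge0// sqrrD -!normrX.
by rewrite !(ger0_norm (sqr_ge0 _)) addrAC lerDl mulrn_wge0// mulr_ge0.
Qed.

Lemma scal_re_eqP (x y : K) : (forall l : K, scal_re (l * x) = scal_re (l * y)) -> x = y.
Proof.
rewrite /scal_re; case: k x y => [x y /(_ 1)|[a b] [c d] H].
  by rewrite !mul1r.
have := H (1 +i* 0)%C; have := H (0 +i* 1)%C => /=.
by rewrite !mul0r !mul1r !sub0r !subr0 => /oppr_inj -> ->.
Qed.

End ScalarParts.

Section ScalarMeasureIntegral.
Context {R : realType} {k : scalar_kind} {T : ptopologicalType}.
Local Notation K := (scalar_field R k).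
Local Notation r2K := (@scal_of_real R k).
Implicit Types (mu : scalar_measure R k T) (f g : T -> K).

Definition scal_bounded_measurable f :=
  bounded_measurable (fun x : borel T => scal_re (f x)) /\
  bounded_measurable (fun x : borel T => scal_im (f x)).
Local Notation bm := scal_bounded_measurable.

Lemma scal_bounded_measurableD f g : bm f -> bm g -> bm (fun x => f x + g x).
Proof.
move=> [rf jf] [rg jg]; split.
  by under eq_fun do rewrite scal_reD; exact: bounded_measurableD.
by under eq_fun do rewrite scal_imD; exact: bounded_measurableD.
Qed.

Lemma scal_bounded_measurableZ (c : K) f : bm f -> bm (fun x => c * f x).
Proof.
move=> [rf jf]; split.
  under eq_fun do rewrite scal_reM.
  by apply: bounded_measurableD; exact: bounded_measurableZ.
under eq_fun do rewrite scal_imM.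
by apply: bounded_measurableD; exact: bounded_measurableZ.
Qed.

Lemma scal_bounded_measurable_sum (I : Type) (s : seq I) (f : I -> T -> K) :
  (forall i, bm (f i)) -> bm (fun x => \sum_(i <- s) f i x).
Proof.
move=> bf; elim: s => [|i s IH].
  split; under eq_fun do rewrite big_nil; split; by [exact: measurable_cst|exact: bounded_cst].
have -> : (fun x => \sum_(j <- i :: s) f j x) = fun x => f i x + \sum_(j <- s) f j x.
  by apply/funext => x; rewrite big_cons.
exact: scal_bounded_measurableD.
Qed.

Lemma scal_bounded_measurable_indic (A : set (borel T)) : measurable A ->
  bm (fun x => r2K (\1_A x)).
Proof.
move=> mA; split.
  under eq_fun do rewrite scal_re_of_real; split; first exact: measurable_indic.
  exact: bounded_indic.
by under eq_fun do rewrite scal_im_of_real; split; [exact: measurable_cst|exact: bounded_cst].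
Qed.

Lemma measure_integralD mu f g : bm f -> bm g ->
  measure_integral mu (fun x => f x + g x) = measure_integral mu f + measure_integral mu g.
Proof.
move=> [rf jf] [rg jg].
have reD : (fun x => scal_re (f x + g x)) = fun x => scal_re (f x) + scal_re (g x).
  by apply/funext => x; rewrite scal_reD.
have imD : (fun x => scal_im (f x + g x)) = fun x => scal_im (f x) + scal_im (g x).
  by apply/funext => x; rewrite scal_imD.
move: rf jf rg jg reD imD; rewrite /scal_im /scal_re.
case: k mu f g => [nu|[nu1 nu2]] f g rf jf rg jg /= reD imD.
  exact: charge_integralD.
rewrite reD imD !charge_integralD//; apply/eqP; rewrite eq_complex /=.
by apply/andP; split; apply/eqP; ring.
Qed.

Lemma measure_integralZ mu (c : K) f : bm f ->
  measure_integral mu (fun x => c * f x) = c * measure_integral mu f.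
Proof.
move=> [rf jf].
have reM : (fun x => scal_re (c * f x)) =
    fun x => scal_re c * scal_re (f x) + - scal_im c * scal_im (f x).
  by apply/funext => x; rewrite scal_reM.
have imM : (fun x => scal_im (c * f x)) =
    fun x => scal_re c * scal_im (f x) + scal_im c * scal_re (f x).
  by apply/funext => x; rewrite scal_imM.
move: rf jf reM imM; rewrite /scal_im /scal_re.
case: k mu c f => [nu|[nu1 nu2]] c f rf jf /= reM imM.
  exact: charge_integralZ.
rewrite reM imM !charge_integralD ?charge_integralZ//; try exact: bounded_measurableZ.
by case: c reM imM => a b _ _; apply/eqP; rewrite eq_complex /=;
  apply/andP; split; apply/eqP; ring.
Qed.

Lemma measure_integral_sum mu (I : Type) (s : seq I) (f : I -> T -> K) :
  (forall i, bm (f i)) ->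
  measure_integral mu (fun x => \sum_(i <- s) f i x) =
  \sum_(i <- s) measure_integral mu (f i).
Proof.
move=> bf; elim: s => [|i s IH].
  rewrite big_nil -[RHS](mul0r (measure_integral mu (fun=> 0))) -measure_integralZ.
    by congr measure_integral; apply/funext => x; rewrite big_nil mul0r.
  by have := @scal_bounded_measurable_sum I [::] f bf; under eq_fun do rewrite big_nil.
rewrite big_cons -IH -measure_integralD//; last exact: scal_bounded_measurable_sum.
by congr measure_integral; apply/funext => x; rewrite big_cons.
Qed.

Lemma measure_integral_indic mu (A : set (borel T)) : measurable A ->
  measure_integral mu (fun x => r2K (\1_A x)) = measure_value mu A.
Proof.
move=> mA; rewrite /measure_integral /measure_value /scal_of_real.
case: k mu => [nu|[nu1 nu2]] /=; first exact: charge_integral_indic.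
have c0 (nu : {charge set (borel T) -> \bar R}) : charge_integral nu (fun=> 0) = 0.
  rewrite -[RHS](mul0r (charge_integral nu (fun=> 0))) -charge_integralZ.
    by congr charge_integral; apply/funext => x; rewrite mul0r.
  by split; [exact: measurable_cst|exact: bounded_cst].
by rewrite !c0 subr0 add0r !charge_integral_indic.
Qed.

(** The crude constant comes from the masses of the Jordan parts and is finite independently of
    [variation]; it expresses the continuity of the integral for uniform convergence. *)
Lemma measure_integral_bound mu : exists2 C, 0 <= C & forall f M, bm f ->
  (forall x, rnorm (f x) <= M) -> rnorm (measure_integral mu f) <= C * M.
Proof.
suff [C C0 H] : exists2 C, 0 <= C & forall f M, bm f -> (forall x, rnorm (f x) <= M) ->
    `|scal_re (measure_integral mu f)| <= C * M /\
    `|scal_im (measure_integral mu f)| <= C * M.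
  exists (C + C); first exact: addr_ge0.
  move=> f M bf fM; have [re im] := H f M bf fM.
  by rewrite mulrDl (le_trans (rnorm_le_parts _))// lerD.
rewrite /scal_re /scal_im /bm /scal_re /scal_im.
have re_le := @normr_scal_re R k; have im_le := @normr_scal_im R k.
move: re_le im_le; rewrite /scal_re /scal_im.
case: k mu => [nu|[nu1 nu2]] re_le im_le.
  have [C [C0 CP]] := charge_integral_bound nu.
  exists C => // f M [[mf _] _] fM.
  have fM' x : `|f x| <= M by apply: le_trans (re_le _) (fM x).
  rewrite normr0 mulr_ge0//; last exact: le_trans (normr_ge0 _) (fM' point).
  by split=> //; exact: CP.
have [C1 [C10 P1]] := charge_integral_bound nu1.
have [C2 [C20 P2]] := charge_integral_bound nu2.
exists (C1 + C2); first exact: addr_ge0.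
move=> f M [[rf _] [jf _]] fM.
have rM x : `|complex.Re (f x)| <= M by apply: le_trans (re_le _) (fM x).
have jM x : `|complex.Im (f x)| <= M by apply: le_trans (im_le _) (fM x).
rewrite /= mulrDl; split.
  by rewrite (le_trans (ler_normB _ _))// lerD ?P1 ?P2.
by rewrite (le_trans (ler_normD _ _))// lerD ?P1 ?P2.
Qed.

End ScalarMeasureIntegral.

(** Rounding the values to a grid of mesh [d] sorts the points into finitely many cells. The first
    clause makes one sample per cell sufficient; the second describes cells as preimages of
    half-open boxes, which gives their measurability. *)
Lemma finite_cells {R : realType} (I : finType) (S : Type) (a : I -> S -> R) (B d : R) :
  (forall i s, `|a i s| <= B) -> 0 < d ->
  exists (L : nat) (c : S -> {ffun I -> 'I_L.+1}),
    (forall s s', c s = c s' -> forall i, `|a i s - a i s'| <= d) /\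
    (forall s j, c s = j <-> forall i, (j i)%:R <= (a i s + B) / d < (j i).+1%:R).
Proof.
move=> aB d0.
have h0 i s : 0 <= (a i s + B) / d.
  rewrite divr_ge0 ?(ltW d0)// -lerBlDl sub0r.
  by rewrite (le_trans _ (aB i s))// -normrN ler_norm.
pose L := Num.truncn ((B + B) / d).
have hL i s : (Num.truncn ((a i s + B) / d) < L.+1)%N.
  rewrite ltnS le_truncn// ler_pM2r ?invr_gt0// lerD2r.
  exact: le_trans (ler_norm _) (aB i s).
pose c s : {ffun I -> 'I_L.+1} := [ffun i => inord (Num.truncn ((a i s + B) / d))].
have cP s j : c s = j <-> forall i, (j i)%:R <= (a i s + B) / d < (j i).+1%:R.
  split=> [<- i|H].
    by rewrite ffunE inordK// truncn_itv.
  apply/ffunP => i; rewrite ffunE; apply/val_inj; rewrite /= inordK//.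
  exact: truncn_def (H i).
exists L, c; split=> // s s' ss' i.
have /(_ i)/andP[l1 u1] := (cP s (c s)).1 erefl.
have /(_ i)/andP[l2 u2] := (cP s' (c s)).1 (esym ss').
rewrite !ler_pdivlMr// in l1 l2; rewrite !ltr_pdivrMr// in u1 u2.
rewrite -natr1 mulrDl mul1r in u1 u2.
by rewrite ler_norml; apply/andP; split; lra.
Qed.

(** * Integrals bounded by the total variation *)

Section VariationBound.
Context {R : realType} {k : scalar_kind} {T : ptopologicalType}.
Local Notation K := (scalar_field R k).
Local Notation r2K := (@scal_of_real R k).

Theorem measure_integral_variation (mu : scalar_measure R k T) (f : T -> K) (M V : R) :
  scal_bounded_measurable f -> (forall x, rnorm (f x) <= M) ->
  (Defs.variation mu setT <= V%:E)%E -> rnorm (measure_integral mu f) <= V * M.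
Proof.
move=> bf fM muV.
have M0 : 0 <= M := le_trans (rnorm_ge0 _) (fM point).
have [C C0 CP] := measure_integral_bound mu.
apply/ler_addgt0Pr => e e0.
(* The simple function below is within 2d of [f], so the crude bound makes the error at most 2Cd <=
   e; the added 1 covers C = 0. *)
pose d := e / (C + C + 1).
have CC0 : 0 < C + C + 1 by rewrite ltr_wpDl// addr_ge0.
have d0 : 0 < d by exact: divr_gt0.
pose a (b : bool) x := if b then scal_re (f x) else scal_im (f x).
have aM b x : `|a b x| <= M.
  by rewrite /a; case: b; apply: le_trans (fM x); [exact: normr_scal_re|exact: normr_scal_im].
have [L [c [c_close cP]]] := finite_cells aM d0.
pose J : finType := {ffun bool -> 'I_L.+1}.
pose P (j : J) : set (borel T) := [set x | c x = j].
have mP j : measurable (P j).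
  pose A b : set (borel T) := [set x | (j b)%:R <= (a b x + M) / d < (j b).+1%:R].
  have mA b : measurable (A b).
    have ma : measurable_fun setT (a b : borel T -> R).
      by rewrite /a; case: bf => -[mr _] [mi _]; case: b.
    have mh : measurable_fun setT (fun x : borel T => (a b x + M) / d).
      by apply: measurable_funM => //; apply: measurable_funD.
    have := mh measurableT _ (measurable_itv `[(j b)%:R, (j b).+1%:R[).
    by rewrite setTI (_ : _ @^-1` _ = A b).
  have -> : P j = A true `&` A false.
    apply/seteqP; split=> x /=; first by move=> /cP H; split; exact: H.
    by move=> [At Af]; apply/cP; case.
  exact: measurableI.
(* The coefficients of the simple function are sampled values of [f], hence still bounded by [M].
   For an empty cell the sample is [point], multiplied by a zero indicator. *)
pose t (j : J) : T := xget point (P j).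
have ct x : c (t (c x)) = c x by rewrite /t; apply: (xgetPex point (P := P (c x))); exists x.
pose s x := \sum_(j : J) f (t j) * r2K (\1_(P j) x).
have sE x : s x = f (t (c x)).
  rewrite /s (bigD1 (c x))//= big1 ?addr0 => [|j jx].
    by rewrite indicE mem_set// scal_of_real1 mulr1.
  rewrite indicE memNset ?scal_of_real0 ?mulr0// => /= cx.
  by rewrite cx eqxx in jx.
have bPj j : scal_bounded_measurable (fun x => f (t j) * r2K (\1_(P j) x)).
  by apply: scal_bounded_measurableZ; exact: scal_bounded_measurable_indic.
have bs : scal_bounded_measurable s.
  exact: (@scal_bounded_measurable_sum R k T J _ _ bPj).
have bN : scal_bounded_measurable (fun x => -1 * s x).
  exact: scal_bounded_measurableZ.
have fs x : rnorm (f x + -1 * s x) <= d + d.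
  rewrite mulN1r sE (le_trans (rnorm_le_parts _))//.
  have H b := c_close x (t (c x)) (esym (ct x)) b.
  by rewrite scal_reB scal_imB lerD ?(H true) ?(H false).
have -> : f = fun x => (f x + -1 * s x) + s x.
  by apply/funext => x; rewrite mulN1r subrK.
rewrite measure_integralD//; last exact: scal_bounded_measurableD.
rewrite addrC (le_trans (rnormD _ _))// lerD//; last first.
  apply: (le_trans (CP _ _ (scal_bounded_measurableD bf bN) fs)).
  rewrite mulrDr -mulrDl /d mulrA ler_pdivrMr// mulrC ler_wpM2l ?(ltW e0)//.
  by rewrite lerDl.
rewrite measure_integral_sum//.
(* The cells form one of the finite partitions over which [variation] is a supremum. *)
have sumV : \sum_(j : J) rnorm (measure_value mu (P j)) <= V.
  rewrite -lee_fin; apply: le_trans muV; apply: ereal_sup_ubound.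
  exists #|J|, (fun i => P (enum_val i)); split=> //.
  - by move=> i i' _ _ [x [/= xi xi']]; apply: enum_val_inj; rewrite -xi -xi'.
  - apply/seteqP; split=> // x _; exists (enum_rank (c x)) => //=.
    by rewrite /P/= enum_rankK.
  - rewrite (eq_bigl (fun j : J => j \in J))// big_enum_val sumEFin.
    by [].
apply: (@le_trans _ _ (\sum_(j : J) rnorm (measure_value mu (P j)) * M)); last first.
  by rewrite -mulr_suml ler_wpM2r.
apply: (le_trans (rnorm_sum _ _ _)); apply: ler_sum => j _.
rewrite measure_integralZ; last exact: scal_bounded_measurable_indic.
by rewrite measure_integral_indic// rnormM mulrC ler_wpM2l// rnorm_ge0.
Qed.

End VariationBound.

(** * Banach-Alaoglu theorem *)

Lemma hausdorff_separating (T V : topologicalType) (I : Type) (f : I -> T -> V) :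
  hausdorff_space V -> (forall i, continuous (f i)) ->
  (forall p q, (forall i, f i p = f i q) -> p = q) -> hausdorff_space T.
Proof.
move=> hV cf sep p q pq; apply: sep => i; apply: hV => A B fA fB.
have [z [zA zB]] := pq _ _ (cf i p _ fA) (cf i q _ fB).
by exists (f i z).
Qed.

Lemma cvg_initial (S : choiceType) (V : topologicalType) (f : S -> V)
    (F : set_system S) (s : S) : Filter F ->
  f @ F --> f s -> F --> (s : initial_topology f).
Proof.
move=> FF Fs A /= [_ [[B oB <-] Bfs sBA]].
by apply: filterS sBA _; apply: Fs; apply: open_nbhs_nbhs.
Qed.

Section ScalarTopology.
Context {R : realType} {k : scalar_kind}.
Local Notation K := (scalar_field R k).
Local Notation r2K := (@scal_of_real R k).

Lemma scal_of_real_lt x y : (r2K x < r2K y) = (x < y).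
Proof. by rewrite !lt_neqAle scal_of_real_le (inj_eq (@scal_of_real_inj R k)). Qed.

Lemma cvg_rnormP (V : normedModType K) (T : Type) (F : set_system T) (f : T -> V) (l : V) :
  Filter F ->
  f @ F --> l <-> forall e : R, 0 < e -> \forall x \near F, rnorm (l - f x) < e.
Proof.
move=> FF; split=> [/cvgrPdist_lt H e e0|H].
  have : 0 < r2K e by rewrite -(scal_of_real0 (k := k)) scal_of_real_lt.
  by move=> /H; apply: filterS => x; rewrite -rnormE scal_of_real_lt.
apply/cvgrPdist_lt => e e0.
have e0' : 0 < scal_re e.
  by rewrite -(scal_of_real_lt 0) scal_of_real0 scal_reK// ltW.
by apply: filterS (H _ e0') => x; rewrite -(scal_of_real_lt _ (scal_re e)) rnormE
  scal_reK// ltW.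
Qed.

Lemma lipschitz_real_continuous (V : normedModType K) (f : V -> R) :
  (forall v w, `|f v - f w| <= rnorm (v - w)) -> continuous f.
Proof.
move=> fl v; apply/(@cvgrPdist_lt R R^o) => e e0.
have : (id : V -> V) @ v --> v by [].
move=> /(@cvg_rnormP V V _ id v _)/(_ e e0); apply: filterS => w.
by apply: le_lt_trans; exact: fl.
Qed.

Lemma scal_re_continuous : continuous (scal_re : K^o -> R).
Proof.
by apply: lipschitz_real_continuous => v w; rewrite -scal_reB; exact: normr_scal_re.
Qed.

Lemma scal_im_continuous : continuous (scal_im : K^o -> R).
Proof.
by apply: lipschitz_real_continuous => v w; rewrite -scal_imB; exact: normr_scal_im.
Qed.

Definition scal_of_parts : R -> R -> K :=
  match k return R -> R -> scalar_field R k with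
  | RealScalars => fun a _ => a
  | ComplexScalars => fun a b => (a +i* b)%C
  end.

Lemma scal_of_partsK (z : K) : scal_of_parts (scal_re z) (scal_im z) = z.
Proof. by rewrite /scal_of_parts /scal_re /scal_im; case: k z => // -[]. Qed.

Lemma scal_re_of_parts a b : scal_re (scal_of_parts a b) = a.
Proof. by rewrite /scal_of_parts /scal_re; case: k. Qed.

Lemma normr_im_of_parts a b c d :
  `|scal_im (scal_of_parts a b) - scal_im (scal_of_parts c d)| <= `|b - d|.
Proof. by rewrite /scal_of_parts /scal_im; case: k => //=; rewrite subrr normr0. Qed.

(** A square rather than a disc: it is the continuous image of a product of two real segments, for
    either kind of scalars. *)
Lemma scal_square_compact (M : R) :
  compact [set z : K^o | `|scal_re z| <= M /\ `|scal_im z| <= M].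
Proof.
pose I : set R^o := [set` `[- M, M]].
pose g (p : R^o * R^o) : K^o := scal_of_parts p.1 p.2.
have cg : continuous g.
  move=> p; apply/cvg_rnormP => e e0.
  have e2 : 0 < e / 2 by exact: divr_gt0.
  have h1 : \forall q \near p, `|p.1 - q.1| < e / 2.
    apply: (@cvgr_dist_lt R R^o _ (nbhs p) _ (fun q : R^o * R^o => q.1) p.1) => //.
    exact: cvg_fst.
  have h2 : \forall q \near p, `|p.2 - q.2| < e / 2.
    apply: (@cvgr_dist_lt R R^o _ (nbhs p) _ (fun q : R^o * R^o => q.2) p.2) => //.
    exact: cvg_snd.
  apply: filterS2 h1 h2 => q h1 h2.
  rewrite (le_lt_trans (rnorm_le_parts _))// scal_reB scal_imB (splitr e) ltrD//.
    by rewrite !scal_re_of_parts.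
  exact: le_lt_trans (normr_im_of_parts _ _ _ _) h2.
have -> : [set z : K^o | `|scal_re z| <= M /\ `|scal_im z| <= M] = g @` (I `*` I).
  apply/seteqP; split=> [z /= [re im]|_ [[a b] /= [aI bI] <-]].
    exists (scal_re z, scal_im z); last exact: scal_of_partsK.
    by split; rewrite /I/= in_itv/= -ler_norml.
  move: aI bI; rewrite /I/= !in_itv/= -!ler_norml => aM bM.
  rewrite scal_re_of_parts; split=> //; apply: le_trans bM.
  have := normr_im_of_parts a b a 0; rewrite subr0; apply: le_trans.
  suff -> : scal_im (scal_of_parts a 0) = 0 by rewrite subr0.
  by rewrite /scal_of_parts /scal_im; case: k.
apply: continuous_compact; first exact: continuous_subspaceT.
by apply: compact_setX; exact: segment_compact.
Qed.

End ScalarTopology.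

Section DualBallTopology.
Context {R : realType} {k : scalar_kind}.
Local Notation K := (scalar_field R k).
Variable X : normedModType K.

Lemma dual_ball_eval_continuous (x : X) :
  continuous (fun p : dual_ball X => dual_ball_val p x : K^o).
Proof.
move=> p.
have c1 : continuous (set_val : dual_ball X -> weak_star X) by exact: initial_continuous.
have c2 : continuous
    ((fun f : dual X => (f : {ptws X -> K^o})) : weak_star X -> {ptws X -> K^o}).
  exact: initial_continuous.
have c3 : {ptws, (fun q : dual_ball X => (dual_ball_val q : X -> K^o)) @ p -->
    (dual_ball_val p : X -> K^o)}.
  exact: (@cvg_comp _ _ _ _ _ _ _ _ (c1 p) (c2 _)).
by have := (pointwise_cvgP _ _).1 c3 x; apply; apply: fmap_filter; exact: nbhs_filter.
Qed.

Lemma dual_ball_rnorm (p : dual_ball X) (x : X) : rnorm (dual_ball_val p x) <= rnorm x.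
Proof.
have /set_mem/= p1 := valP p.
rewrite (le_trans (clin_rnorm_le _ _))// ler_piMl ?rnorm_ge0//.
by rewrite -rnorm_le1.
Qed.

Lemma cvg_dual_ball (F : set_system (dual_ball X)) (p : dual_ball X) : Filter F ->
  (forall x, (fun q : dual_ball X => dual_ball_val q x : K^o) @ F -->
    (dual_ball_val p x : K^o)) ->
  F --> p.
Proof.
move=> FF H; apply: cvg_initial; apply: cvg_initial.
by apply/pointwise_cvgP => x; exact: H.
Qed.

Lemma dual_ball_inj (p q : dual_ball X) :
  (forall x, dual_ball_val p x = dual_ball_val q x) -> p = q.
Proof. by move=> pq; apply/val_inj/val_inj/funext. Qed.

Lemma dual_ball_exists (f : X -> K^o) : linear f ->
  (forall x, rnorm (f x) <= rnorm x) -> exists p : dual_ball X, dual_ball_val p =1 f.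
Proof.
move=> lf fb; have fb1 x : rnorm (f x) <= 1 * rnorm x by rewrite mul1r.
pose g : dual X := CLin (linear_bounded_clin_pred lf fb1).
have g1 : [set f : weak_star X | unit_ball (dual X) f] g.
  rewrite /= rnorm_le1 clin_rnormE; apply: (sup_norm_le (@unit_ball_neq0 _ _ X)) => x /=.
  by rewrite rnorm_le1 => x1; rewrite (le_trans (fb x)).
by exists (SigSub (mem_set g1)).
Qed.

(** Along an ultrafilter every evaluation stays in a compact square and so converges; the pointwise
    limit is again linear and of norm at most 1, hence a point of the ball. *)
Theorem banach_alaoglu : compact [set: dual_ball X].
Proof.
rewrite compact_ultra => F UF _; rewrite setTI.
have FF : ProperFilter F by exact: ultra_proper.
pose ev (x : X) (q : dual_ball X) : K^o := dual_ball_val q x.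
have ev_cvg x : exists l : K^o, ev x @ F --> l.
  have FB : (ev x @ F) [set z : K^o | `|scal_re z| <= rnorm x /\ `|scal_im z| <= rnorm x].
    rewrite fmapE; apply: filterE => q /=; split; apply: (le_trans _ (dual_ball_rnorm q x)).
      exact: normr_scal_re.
    exact: normr_scal_im.
  have [l [_ cl]] := scal_square_compact (fmap_proper_filter _ FF) FB.
  exists l => A lA.
  (* A cluster point of an ultrafilter is a limit: otherwise the complement of a neighbourhood would
     belong to it. *)
  have [//|FnA] := in_ultra_setVsetC (ev x @^-1` A) UF.
  by have [z []] := cl (~` A) A FnA lA.
have [L LP] := choice ev_cvg.
have Ll : linear (L : X -> K^o).
  move=> a x y.
  have FFx : ProperFilter (ev (a *: x + y) @ F) by exact: fmap_proper_filter.
  apply: (@cvg_unique K^o (@norm_hausdorff K K^o) _ FFx); first exact: LP.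
  rewrite /= (_ : ev _ = (fun q => a *: ev x q + ev y q)).
    apply: (@cvgD K K^o); last exact: LP.
    by apply: (@cvgZl_tmp K K^o); exact: LP.
  by apply/funext => q; rewrite /ev linearP.
have Lb x : rnorm (L x) <= rnorm x.
  apply/ler_addgt0Pr => e e0.
  have : \forall q \near F, rnorm (L x - ev x q) < e.
    by move: e e0; apply/cvg_rnormP; exact: LP.
  move=> /filter_ex[q qe].
  rewrite -(subrK (ev x q) (L x)) addrC (le_trans (rnormD _ _))// lerD ?(ltW qe)//.
  exact: dual_ball_rnorm.
have [p pL] := dual_ball_exists Ll Lb.
by exists p; apply: cvg_dual_ball => x; rewrite pL; exact: LP.
Qed.

End DualBallTopology.

(** * The compact Hausdorff space carrying the measures *)

Section IntegralDomainSpace.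
Context {R : realType} {k : scalar_kind}.
Local Notation K := (scalar_field R k).
Variables X Y : normedModType K.
Local Notation Omega := (dual_ball X * dual_ball Y)%type.

Lemma compact_dual_balls : compact [set: Omega].
Proof. by rewrite -setXTT; apply: compact_setX; exact: banach_alaoglu. Qed.

Lemma eval1_continuous x : continuous (fun p : Omega => dual_ball_val p.1 x : K^o).
Proof.
move=> p; apply: (@continuous_comp _ _ _ fst (fun q => dual_ball_val q x : K^o)).
  exact: cvg_fst.
exact: dual_ball_eval_continuous.
Qed.

Lemma eval2_continuous y : continuous (fun p : Omega => dual_ball_val p.2 y : K^o).
Proof.
move=> p; apply: (@continuous_comp _ _ _ snd (fun q => dual_ball_val q y : K^o)).
  exact: cvg_snd.
exact: dual_ball_eval_continuous.
Qed.

Lemma hausdorff_dual_balls : hausdorff_space Omega.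
Proof.
apply: (@hausdorff_separating _ K^o (X + Y)%type (fun i p =>
  match i with inl x => dual_ball_val p.1 x | inr y => dual_ball_val p.2 y end)).
- exact: norm_hausdorff.
- by case=> [x|y]; [exact: eval1_continuous|exact: eval2_continuous].
- move=> [p1 p2] [q1 q2] H; congr pair; apply: dual_ball_inj => z.
    exact: (H (inl z)).
  exact: (H (inr z)).
Qed.

Lemma eval_product_continuous x y :
  continuous (fun p : Omega => dual_ball_val p.1 x * dual_ball_val p.2 y : K^o).
Proof.
by move=> p; apply: cvgM; [exact: eval1_continuous|exact: eval2_continuous].
Qed.

Lemma eval_product_bounded_measurable x y :
  scal_bounded_measurable (fun p : Omega => dual_ball_val p.1 x * dual_ball_val p.2 y).
Proof.
have cre : continuous (fun p : Omega => scal_re (dual_ball_val p.1 x * dual_ball_val p.2 y)).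
  move=> p; apply: (@continuous_comp _ K^o _ (fun q : Omega =>
    dual_ball_val q.1 x * dual_ball_val q.2 y) scal_re).
    exact: eval_product_continuous.
  exact: scal_re_continuous.
have cim : continuous (fun p : Omega => scal_im (dual_ball_val p.1 x * dual_ball_val p.2 y)).
  move=> p; apply: (@continuous_comp _ K^o _ (fun q : Omega =>
    dual_ball_val q.1 x * dual_ball_val q.2 y) scal_im).
    exact: eval_product_continuous.
  exact: scal_im_continuous.
split; split; [exact: continuous_borel_measurable| |exact: continuous_borel_measurable|];
  by apply: continuous_bounded_fct => //; exact: compact_dual_balls.
Qed.

End IntegralDomainSpace.

(** * Positive representing measures *)

Section BoundedFunctionSpace.
Context {R : realType} (T : Type).

Definition bfct_pred : {pred T -> R} := fun f => `[< bounded_fct f >].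

Record bfct := BFct { bfct_fun :> T -> R ; bfct_funP : bfct_fun \in bfct_pred }.

HB.instance Definition _ := [isSub for bfct_fun].
HB.instance Definition _ := [Choice of bfct by <:].

Lemma bfct_subsemimod_closed : subsemimod_closed bfct_pred.
Proof.
split; [split|] => [|f g /asboolP bf /asboolP bg|t f /asboolP bf]; apply/asboolP.
- exact: bounded_cst.
- exact: bounded_fctD.
- exact: bounded_fctZ.
Qed.

HB.instance Definition _ :=
  GRing.SubChoice_isSubLmodule.Build R (T -> R) bfct_pred bfct bfct_subsemimod_closed.

End BoundedFunctionSpace.

Section PositiveExtension.
Context {R : realType} {T : pointedType}.

(* A linear functional dominated by [N * sup] is automatically positive. *)
Theorem positive_extension (G : set ((T -> R) * R)) (N : R) : 0 <= N ->
  G (fun=> 0, 0) ->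
  (forall t f c g d, G (f, c) -> G (g, d) -> G (fun x => t * f x + g x, t * c + d)) ->
  (forall f c, G (f, c) -> bounded_fct f /\
    forall B, (forall x, f x <= B) -> c <= N * B) ->
  exists L : (T -> R) -> R, [/\
    forall f g, bounded_fct f -> bounded_fct g -> L (fun x => f x + g x) = L f + L g,
    forall t f, bounded_fct f -> L (fun x => t * f x) = t * L f,
    forall f, bounded_fct f -> (forall x, 0 <= f x) -> 0 <= L f,
    L (fun=> 1) <= N &
    forall f c, G (f, c) -> L f = c].
Proof.
move=> N0 G0 GD GN.
pose V : lmodType (scalar_field R RealScalars) := bfct T.
pose p (f : V) := N * sup (range (f : bfct T)).
have rng0 (f : V) : range (f : bfct T) !=set0 by exists ((f : bfct T) point); exists point.
have bnd (f : V) : bounded_fct (f : bfct T) by exact/asboolP/(bfct_funP (f : bfct T)).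
have le_rng (f : V) x : (f : bfct T) x <= sup (range (f : bfct T)).
  apply: ub_le_sup; last by exists x.
  by have [M fM] := bnd f; exists M => _ [y _ <-]; exact: le_trans (ler_norm _) (fM y).
have rng_le (f : V) B : (forall x, (f : bfct T) x <= B) -> sup (range (f : bfct T)) <= B.
  by move=> fB; apply: ge_sup => // _ [y _ <-].
have psub : @real_sublinear R RealScalars V p.
  split=> [f g|t f t0].
    rewrite /p -mulrDr ler_wpM2l//; apply: rng_le => x.
    by rewrite [leLHS]/((f : bfct T) x + (g : bfct T) x) lerD.
  rewrite /p mulrCA; congr (_ * _); apply/eqP; rewrite eq_le; apply/andP; split.
    by apply: rng_le => x; rewrite [leLHS]/(t * (f : bfct T) x) ler_pM2l.
  rewrite -ler_pdivlMl//; apply: rng_le => x; rewrite ler_pdivlMl//.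
  exact: (le_rng (t *: f : bfct T) x).
pose H : set (V * R) := [set fc | G ((fc.1 : bfct T) : T -> R, fc.2)].
have lH : real_linear_rel H.
  split; first exact: G0.
  by move=> t f c g d; exact: GD.
have dH : dominated p H.
  by move=> f c /GN[_]; apply=> x; exact: le_rng.
have [g [gD gZ gp gH]] := hahn_banach_real psub lH dH.
(* The functional is made total by the value 0 on unbounded functions. *)
pose L (f : T -> R) : R := if pselect (bounded_fct f) is left bf then
  g (BFct (introT (asboolP _) bf)) else 0.
have LE (f : V) : L (f : bfct T) = g f.
  rewrite /L; case: pselect => [bf|/(_ (bnd f))//]; congr g; exact: val_inj.
have lift f : bounded_fct f -> exists h : V, f = (h : bfct T).
  by move=> bf; exists (BFct (introT (asboolP _) bf)).
exists L; split.
- by move=> _ _ /lift[f ->] /lift[h ->]; rewrite !LE -gD -LE.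
- by move=> t _ /lift[f ->]; rewrite LE -gZ -LE.
- move=> _ /lift[f ->] f0; rewrite LE; have := gZ (-1) f; rewrite mulN1r => gN.
  rewrite -[g f]opprK -gN oppr_ge0; apply: (le_trans (gp _)).
  rewrite /p mulr_ge0_le0//; apply: rng_le => x.
  rewrite (_ : bfct_fun _ x = - (f : bfct T) x) ?oppr_le0//.
  exact: (mulN1r ((f : bfct T) x)).
- have /lift[h hE] : bounded_fct (fun _ : T => 1 : R) by exact: bounded_cst.
  rewrite hE LE; apply: (le_trans (gp _)); rewrite /p ler_piMr//.
  by apply: rng_le => x; rewrite -hE.
- move=> f c fc; have [/lift[h hE] _] := GN _ _ fc.
  by rewrite hE LE; apply: gH; rewrite /H/= -hE.
Qed.

End PositiveExtension.

Section PositiveMeasure.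
Context {R : realType} {k : scalar_kind} {T : ptopologicalType}.
Local Notation K := (scalar_field R k).
Local Notation r2K := (@scal_of_real R k).
Variable m : {finite_measure set (borel T) -> \bar R}.

Definition positive_scalar_measure : scalar_measure R k T :=
  match k return scalar_measure R k T with
  | RealScalars => charge_of_finite_measure m
  | ComplexScalars => (charge_of_finite_measure m : {charge set (borel T) -> \bar R},
      charge_of_finite_measure mzero : {charge set (borel T) -> \bar R})
  end.
Local Notation mu := positive_scalar_measure.

Lemma positive_measure_value A : measure_value mu A = r2K (fine (m A)).
Proof.
rewrite /measure_value /positive_scalar_measure /scal_of_real.
by case: k => //=; rewrite /charge_of_finite_measure/= /mzero.
Qed.

Lemma positive_measure_integral (f : T -> K) :
  scal_re (measure_integral mu f) = \int[m]_x scal_re (f x).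
Proof.
rewrite /measure_integral /positive_scalar_measure /scal_re.
case: k f => f /=; rewrite !charge_integral_measure//.
by rewrite [X in _ - X]/Rintegral integral_measure_zero subr0.
Qed.

Lemma positive_measure_variation (A : set (borel T)) : (Defs.variation mu A <= m A)%E.
Proof.
apply: ge_ereal_sup => _ [n [P [mP tP <- ->]]].
under eq_bigr do rewrite positive_measure_value rnorm_of_real ?fine_ge0// fineK
  ?fin_num_measure//.
have -> : \bigcup_j P j = \big[setU/set0]_(j < n) P j.
  rewrite -(bigcup_seq (index_enum 'I_n) P); apply: eq_bigcupl.
  by split=> // j _ /=; rewrite mem_index_enum.
by rewrite measure_semi_additive_ord//; exact: bigsetU_measurable.
Qed.

End PositiveMeasure.

Section DominatedIntegral.
Context {R : realType} {k : scalar_kind}.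
Local Notation K := (scalar_field R k).
Local Notation r2K := (@scal_of_real R k).
Context {X Y : normedModType K}.
Local Notation Omega := (dual_ball X * dual_ball (dual Y))%type.
Implicit Types (u : clin X Y) (s : seq (X * dual Y)).

(** Lists of pairs stand for elements of the algebraic tensor product of X and Y^*, here viewed as
    functions on Omega. *)
Definition tensor_fct s (p : Omega) : K :=
  \sum_(z <- s) dual_ball_val p.1 z.1 * dual_ball_val p.2 z.2.

Definition tensor_eval u s : K := \sum_(z <- s) (z.2 : dual Y) (u z.1).

Definition scale_tensor {Z W : Type} (f : Z -> Z) (s : seq (Z * W)) :=
  [seq (f z.1, z.2) | z <- s].

Lemma tensor_fct_cat s1 s2 p :
  tensor_fct (s1 ++ s2) p = tensor_fct s1 p + tensor_fct s2 p.
Proof. by rewrite /tensor_fct big_cat. Qed.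

Lemma tensor_eval_cat u s1 s2 :
  tensor_eval u (s1 ++ s2) = tensor_eval u s1 + tensor_eval u s2.
Proof. by rewrite /tensor_eval big_cat. Qed.

Lemma tensor_fctZ (l : K) s p :
  tensor_fct (scale_tensor ( *:%R l) s) p = l * tensor_fct s p.
Proof.
rewrite /tensor_fct big_map mulr_sumr; apply: eq_bigr => z _ /=.
by rewrite linearZ/= mulrA.
Qed.

Lemma tensor_evalZ u (l : K) s :
  tensor_eval u (scale_tensor ( *:%R l) s) = l * tensor_eval u s.
Proof.
rewrite /tensor_eval big_map mulr_sumr; apply: eq_bigr => z _ /=.
by rewrite linearZ/= linearZ.
Qed.

Lemma tensor_fct_bounded_measurable s : scal_bounded_measurable (tensor_fct s).
Proof.
by apply: scal_bounded_measurable_sum => z; exact: eval_product_bounded_measurable.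
Qed.

Theorem integral_of_dominated u (N : R) : 0 <= N ->
  (forall s B, (forall p, scal_re (tensor_fct s p) <= B) ->
    scal_re (tensor_eval u s) <= N * B) ->
  exists mu, [/\ regular_measure mu, represents mu u &
    (Defs.variation mu setT <= N%:E)%E].
Proof.
move=> N0 uN.
pose G : set ((Omega -> R) * R) := [set fc | exists s,
  fc = (fun p => scal_re (tensor_fct s p), scal_re (tensor_eval u s))].
have G0 : G (fun=> 0, 0).
  exists [::]; rewrite /tensor_eval big_nil scal_re0; congr pair.
  by apply/funext => p; rewrite /tensor_fct big_nil scal_re0.
have GD t f c g d : G (f, c) -> G (g, d) -> G (fun x => t * f x + g x, t * c + d).
  move=> [s1 [-> ->]] [s2 [-> ->]].
  exists (scale_tensor ( *:%R (r2K t)) s1 ++ s2).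
  rewrite tensor_eval_cat tensor_evalZ scal_reD scal_reZ; congr pair.
  by apply/funext => p; rewrite tensor_fct_cat tensor_fctZ scal_reD scal_reZ.
have GN f c : G (f, c) -> bounded_fct f /\ forall B, (forall x, f x <= B) -> c <= N * B.
  move=> [s [-> ->]]; split; last by move=> B; exact: uN.
  by have [[]] := tensor_fct_bounded_measurable s.
have [L [LD LZ L0 L1 LG]] := positive_extension N0 G0 GD GN.
have [m [mT mreg mL]] := riesz_markov (@hausdorff_dual_balls R k X (dual Y))
  (@compact_dual_balls R k X (dual Y)) LD LZ L0.
exists (positive_scalar_measure m); split.
- move=> A e mA e0; have [C [U [cC oU CA AU mUC]]] := mreg A e mA e0.
  by exists C, U; split=> //; exact: le_trans (positive_measure_variation _ _) mUC.
(* The functional controls real parts only; multiplying by every scalar [l], absorbed into [x],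
   recovers the full scalar identity. *)
- move=> x y'; apply: scal_re_eqP => l.
  have bm := @eval_product_bounded_measurable R k X (dual Y) x y'.
  rewrite -measure_integralZ// positive_measure_integral.
  have -> : (fun p : Omega => scal_re (l * (dual_ball_val p.1 x * dual_ball_val p.2 y'))) =
      fun p => scal_re (tensor_fct [:: (l *: x, y')] p).
    by apply/funext => p; rewrite /tensor_fct big_seq1/= linearZ/= mulrA.
  rewrite mL; last first.
    move=> p.
    have -> : (fun p => scal_re (tensor_fct [:: (l *: x, y')] p)) = scal_re \o
        (fun q : Omega => dual_ball_val q.1 (l *: x) * dual_ball_val q.2 y' : K^o).
      by apply/funext => q /=; rewrite /tensor_fct big_seq1.
    apply: (@continuous_comp _ K^o); first exact: eval_product_continuous.
    exact: scal_re_continuous.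
  rewrite (LG _ (scal_re (l * y' (u x)))) //.
  exists [:: (l *: x, y')]; congr pair.
  by rewrite /tensor_eval big_seq1/= !linearZ.
- by rewrite (le_trans (positive_measure_variation _ _))// mT lee_fin.
Qed.

End DominatedIntegral.

(** * Factorization of functionals through finite powers of a space *)

Section DualFactorization.
Context {R : realType} {k : scalar_kind}.
Local Notation K := (scalar_field R k).
Local Notation r2K := (@scal_of_real R k).

Lemma clin_rnorm_le_bound (X Y : normedModType K) (f : clin X Y) (M : R) : 0 <= M ->
  (forall x, rnorm (f x) <= M * rnorm x) -> rnorm f <= M.
Proof.
move=> M0 fM; rewrite clin_rnormE; apply: (sup_norm_le (@unit_ball_neq0 _ _ X)) => x /=.
by rewrite rnorm_le1 => x1; rewrite (le_trans (fM x))// ler_piMr.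
Qed.

Lemma dual_rnorm_approx (X : normedModType K) (f : dual X) (e : R) : 0 < e ->
  exists2 z : X, rnorm z <= 1 & rnorm f - e <= scal_re (f z).
Proof.
move=> e0.
have hs : has_sup [set rnorm (f x) | x in unit_ball X].
  split; first by have [x Bx] := @unit_ball_neq0 _ _ X; exists (rnorm (f x)); exists x.
  by have [M fM] := clin_bounded f; exists M => _ [x Bx <-]; exact: fM.
have [_ [x Bx <-] fx] := sup_adherent e0 hs.
have [l l1 lf] := phase_exists (f x).
exists (l *: x); first by rewrite rnormZ l1 mul1r -rnorm_le1.
by rewrite linearZ/= [_ *: _]lf scal_re_of_real clin_rnormE ltW.
Qed.

Variables (F : normedModType K) (I J : finType) (i0 : I).
Variables (a : I -> J -> K) (g : J -> dual F) (N eta : R).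
Hypotheses (N0 : 0 <= N) (eta0 : 0 <= eta).
Hypothesis gN : forall (y : J -> F) (B : R),
  (forall i, rnorm (\sum_j a i j *: y j) <= B) ->
  rnorm (\sum_j g j (y j)) <= N * (B + eta * \sum_j rnorm (y j)).

(* Hahn-Banach in the product of [I -> F] (sup norm) and [J -> F] (eta times the
   l^1 norm), into which [y] is mapped by [(fun i => \sum_j a i j *: y j, y)]. *)
Lemma dual_factorization : exists (h : I -> dual F) (r : J -> dual F),
  [/\ forall j, g j = \sum_i a i j *: h i + r j,
    \sum_i rnorm (h i) <= N & forall j, rnorm (r j) <= N * eta].
Proof.
pose V : lmodType K := ((I -> F) * (J -> F))%type.
pose q (v : V) : R := N * (sup_norm setT (v.1 : I -> F) + eta * \sum_j rnorm (v.2 j)).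
have I0 : [set: I] !=set0 by exists i0.
have bI (z : I -> F) : norm_bounded_on setT z.
  by exists (\sum_i rnorm (z i)) => i _; rewrite (bigD1 i)//= lerDl sumr_ge0// => j _;
    exact: rnorm_ge0.
have qD v w : q (v + w) <= q v + q w.
  rewrite /q -mulrDr ler_wpM2l// addrACA lerD//; first exact: sup_normD.
  by rewrite -mulrDr ler_wpM2l// -big_split/=; apply: ler_sum => j _; exact: rnormD.
have qZ l v : q (l *: v) = rnorm l * q v.
  rewrite /q mulrCA; congr (_ * _); rewrite mulrDr sup_normZ//; congr (_ + _).
  rewrite mulrCA; congr (_ * _); rewrite mulr_sumr.
  by apply: eq_bigr => j _; exact: rnormZ.
pose Ty (y : J -> F) : V := (fun i => \sum_j a i j *: y j, y).
pose G : set (V * K) := [set vc | exists y, vc = (Ty y, \sum_j g j (y j))].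
have G0 : G (0, 0).
  exists (fun=> 0); congr pair; last by rewrite big1// => j _; rewrite linear0.
  by congr pair; apply/funext => i; rewrite big1// => j _; rewrite scaler0.
have GD l v c w d : G (v, c) -> G (w, d) -> G (l *: v + w, l * c + d).
  move=> [y [-> ->]] [z [-> ->]]; exists (fun j => l *: y j + z j); congr pair.
    congr pair; apply/funext => i.
    change (l *: (\sum_j a i j *: y j) + \sum_j a i j *: z j =
      \sum_j a i j *: (l *: y j + z j)).
    rewrite scaler_sumr -big_split/=; apply: eq_bigr => j _.
    by rewrite scalerDr !scalerA mulrC.
  by rewrite mulr_sumr -big_split/=; apply: eq_bigr => j _; rewrite linearP.
have Gq v c : G (v, c) -> rnorm c <= q v.
  by move=> [y [-> ->]]; apply: gN => i; exact: (le_sup_norm (bI _)).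
have [H [Hlin Hq HG]] := hahn_banach qD qZ G0 GD Gq.
have H0 : H 0 = 0 by exact: HG.
have HD v w : H (v + w) = H v + H w by have := Hlin 1 v w; rewrite scale1r mul1r.
have HZ l v : H (l *: v) = l * H v by have := Hlin l v 0; rewrite !addr0 H0 addr0.
(* The coordinate embeddings: composing the extension [H] with them yields its components [h] and
   [r]. *)
pose d1 i (z : F) : V := (fun i' => if i' == i then z else 0, 0).
pose d2 j (z : F) : V := (0, fun j' => if j' == j then z else 0).
have d1l i : linear (fun z : F => H (d1 i z) : K^o).
  move=> l y z; rewrite -[RHS]Hlin; congr (H (_, _)).
    apply/funext => i'; change ((if i' == i then l *: y + z else 0) =
      l *: (if i' == i then y else 0) + (if i' == i then z else 0)).
    by case: ifP => // _; rewrite scaler0 addr0.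
  by change (0 = l *: (0 : J -> F) + 0); rewrite scaler0 addr0.
have d2l j : linear (fun z : F => H (d2 j z) : K^o).
  move=> l y z; rewrite -[RHS]Hlin; congr (H (_, _)).
    by change (0 = l *: (0 : I -> F) + 0); rewrite scaler0 addr0.
  apply/funext => j'; change ((if j' == j then l *: y + z else 0) =
    l *: (if j' == j then y else 0) + (if j' == j then z else 0)).
  by case: ifP => // _; rewrite scaler0 addr0.
have d1b i z : rnorm (H (d1 i z) : K^o) <= N * rnorm z.
  apply: (le_trans (Hq _)); rewrite /q ler_wpM2l//=.
  rewrite [X in _ * X]big1 ?mulr0 ?addr0 => [|j _]; last by rewrite rnorm0.
  by apply: sup_norm_le => // i' _; case: ifP => // _; rewrite rnorm0 rnorm_ge0.
have d2b j z : rnorm (H (d2 j z) : K^o) <= (N * eta) * rnorm z.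
  apply: (le_trans (Hq _)); rewrite /q -mulrA ler_wpM2l//=.
  rewrite (bigD1 j)//= eqxx big1 ?addr0 => [|j' /negPf->]; last by rewrite rnorm0.
  by rewrite gerDr; apply: sup_norm_le => // i _; rewrite rnorm0.
pose h i : dual F := CLin (linear_bounded_clin_pred (d1l i) (d1b i)).
pose r j : dual F := CLin (linear_bounded_clin_pred (d2l j) (d2b j)).
have Hsum (W : finType) (f : W -> V) : H (\sum_w f w) = \sum_w H (f w).
  by elim/big_rec2 : _ => // w y z _ <-; rewrite HD.
have decomp (v : V) : v = \sum_i d1 i (v.1 i) + \sum_j d2 j (v.2 j).
  have fstD (W : finType) (f : W -> V) : (\sum_w f w).1 = \sum_w (f w).1.
    by elim/big_rec2 : _ => // w y z _ <-.
  have sndD (W : finType) (f : W -> V) : (\sum_w f w).2 = \sum_w (f w).2.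
    by elim/big_rec2 : _ => // w y z _ <-.
  case: v => z w /=; rewrite [RHS]surjective_pairing; congr pair.
    change (z = (\sum_i d1 i (z i)).1 + (\sum_j d2 j (w j)).1).
    rewrite !fstD [X in _ + X]big1// addr0; apply/funext => i.
    rewrite fct_sumE (bigD1 i)//= eqxx big1 ?addr0// => i' ii'.
    by rewrite eq_sym (negPf ii').
  change (w = (\sum_i d1 i (z i)).2 + (\sum_j d2 j (w j)).2).
  rewrite !sndD [X in X + _]big1// add0r; apply/funext => j.
  rewrite fct_sumE (bigD1 j)//= eqxx big1 ?addr0// => j' jj'.
  by rewrite eq_sym (negPf jj').
have HE z w : H (z, w) = \sum_i h i (z i) + \sum_j r j (w j).
  by rewrite [in LHS](decomp (z, w)) HD !Hsum.
have pick1 (W : finType) (w0 : W) (U : lmodType K) (f : W -> F -> U) (y : F) :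
    (forall w, f w 0 = 0) -> \sum_w f w (if w == w0 then y else 0) = f w0 y.
  move=> f0; rewrite (bigD1 w0)//= eqxx big1 ?addr0// => w /negPf->; exact: f0.
exists h, r; split.
- move=> j; apply/val_inj/funext => y.
  change (g j y = (\sum_i a i j *: h i : dual F) y + r j y).
  have := HG _ _ (ex_intro _ (fun j' => if j' == j then y else 0) erefl).
  rewrite (pick1 _ j K^o (fun j' => g j')) => [|j']; last exact: linear0.
  rewrite HE (pick1 _ j K^o (fun j' => r j')) => [<-|j']; last exact: linear0.
  under eq_bigr => i _.
    rewrite (pick1 _ j F (fun j' z => a i j' *: z)) => [|j']; last exact: scaler0.
    over.
  congr (_ + _); elim/big_rec2 : _ => // i b c _ ->.
  by rewrite linearZ.
(* The sup norm is dual to the l^1 sum: nearly norming vectors of all the [h i] form one family of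
   sup norm at most 1, on which [H] is at most [N]. Their errors add up to at most [e]. *)
- apply/ler_addgt0Pr => e e0.
  have cardI : 0 < #|I|.+1%:R :> R by [].
  have e'0 : 0 < e / #|I|.+1%:R by exact: divr_gt0.
  have att i : exists z : F, rnorm z <= 1 /\ rnorm (h i) - e / #|I|.+1%:R <= scal_re (h i z).
    by have [z z1 hz] := dual_rnorm_approx (h i) e'0; exists z.
  have [z zP] := choice att.
  have : scal_re (H ((z, 0) : V)) <= N.
    rewrite (le_trans (scal_re_le_rnorm _))// (le_trans (Hq _))// /q ler_piMr//=.
    rewrite big1 ?mulr0 ?addr0 => [|j _]; last by rewrite rnorm0.
    by apply: sup_norm_le => // i _; have [] := zP i.
  rewrite HE [X in _ + X]big1 ?addr0 => [|j _]; last by rewrite linear0.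
  have -> : scal_re (\sum_i h i (z i) : K) = \sum_i scal_re (h i (z i)).
    elim/big_rec2 : _ => [|i b c _ <-]; [exact: scal_re0|exact: scal_reD].
  rewrite -(lerD2r e); apply: le_trans; rewrite -lerBlDr.
  apply: (@le_trans _ _ (\sum_i (rnorm (h i) - e / #|I|.+1%:R))); last first.
    by apply: ler_sum => i _; have [] := zP i.
  rewrite sumrB lerD2l lerN2 sumr_const -[_ *+ #|_|]mulr_natl mulrA ler_pdivrMr// mulrC.
  by rewrite ler_wpM2l ?(ltW e0)// ler_nat.
- move=> j; apply: clin_rnorm_le_bound; first exact: mulr_ge0.
  exact: d2b.
Qed.

End DualFactorization.

(** * The hyper-Borel transform *)

Section HyperBorelIsometry.
Context {R : realType} {k : scalar_kind}.
Local Notation K := (scalar_field R k).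
Local Notation r2K := (@scal_of_real R k).
Context {n : nat} {E : 'I_n -> completeNormedModType K} {F : normedModType K}.
Local Notation X := (mlin E K^o).
Local Notation Y := (dual F).
Implicit Types (phi : dual (fr_closure E F)).

Definition fr_sum (W : Type) (s : seq W) (A : W -> X) (y : W -> F) : fr_closure E F :=
  \sum_(w <- s) fr_tens (A w) (y w).

Lemma fr_sumE (W : Type) (s : seq W) (A : W -> X) (y : W -> F) (x : forall i, E i) :
  fr_closure_val (fr_sum s A y) x = \sum_(w <- s) A w x *: y w.
Proof. by rewrite /fr_sum; elim/big_rec2 : _ => // w b c _ <-. Qed.

Lemma fr_closure_rnorm_le (T : fr_closure E F) (M : R) :
  (forall x, unit_ball_prod E x -> rnorm (fr_closure_val T x) <= M) -> rnorm T <= M.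
Proof.
move=> TM; change (rnorm (fr_closure_val T) <= M); rewrite mlin_rnormE.
by apply: (sup_norm_le (@unit_ball_prod_neq0 _ _ _ E)).
Qed.

Lemma mlin_rnorm_le (A : X) x : unit_ball_prod E x -> rnorm (A x) <= rnorm A.
Proof. by move=> Bx; rewrite mlin_rnormE; exact: le_sup_norm (mlin_bounded A) Bx. Qed.

Lemma fr_closure_rnorm_ge (T : fr_closure E F) x :
  unit_ball_prod E x -> rnorm (fr_closure_val T x) <= rnorm T.
Proof.
move=> Bx; change (rnorm (fr_closure_val T x) <= rnorm (fr_closure_val T)).
by rewrite mlin_rnormE; exact: le_sup_norm (mlin_bounded _) Bx.
Qed.

Lemma point_eval_dual_ball x : unit_ball_prod E x ->
  exists p : dual_ball X, forall A, dual_ball_val p A = A x.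
Proof.
move=> Bx; have [//|A|p pE] := @dual_ball_exists R k X (fun A => A x); last by exists p.
exact: mlin_rnorm_le.
Qed.

Lemma dual_eval_dual_ball (V : normedModType K) (v : V) : rnorm v <= 1 ->
  exists p : dual_ball (dual V), forall g, dual_ball_val p g = g v.
Proof.
move=> v1; have [//|g|p pE] := @dual_ball_exists R k (dual V) (fun g => g v); last by exists p.
by rewrite (le_trans (clin_rnorm_le _ _))// ler_piMr// rnorm_ge0.
Qed.

Lemma scal_re_sum (W : Type) (s : seq W) (f : W -> K) :
  scal_re (\sum_(w <- s) f w) = \sum_(w <- s) scal_re (f w).
Proof. by elim/big_rec2 : _ => [|w b c _ <-]; [exact: scal_re0|exact: scal_reD]. Qed.

(* The y'' in [s] lie in the bidual of F, and need not be w*-continuous on F*.  A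
   finite net [rep i] of the ball writes each [hyper_borel phi (A j)] as
   [\sum_i A j (rep i) *: h i] up to a small error with [\sum_i rnorm (h i) <= rnorm phi],
   so that only finitely many elements of F* are evaluated by the y''. *)
Lemma hyper_borel_dominated phi (s : seq (X * dual Y)) (B : R) :
  (forall p, scal_re (tensor_fct s p) <= B) ->
  scal_re (tensor_eval (hyper_borel phi) s) <= rnorm phi * B.
Proof.
move=> sB; apply/ler_addgt0Pr => e e0.
set N := rnorm phi; have N0 : 0 <= N by exact: rnorm_ge0.
pose J : finType := 'I_(size s).
pose A (j : J) : X := (nth (0, 0) s j).1.
pose Y2 (j : J) : dual Y := (nth (0, 0) s j).2.
have sumJ (V : nmodType) (f : X -> dual Y -> V) :
    \sum_(z <- s) f z.1 z.2 = \sum_j f (A j) (Y2 j).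
  by rewrite (big_nth (0, 0)) big_mkord.
pose S := {x : forall i, E i | unit_ball_prod E x}.
pose s0 : S := exist _ _ (svalP (cid (@unit_ball_prod_neq0 _ _ _ E))).
(* Real and imaginary parts are separate coordinates, so that one real grid treats all the forms at
   once. *)
pose co (jb : J * bool) (x : S) : R :=
  if jb.2 then scal_re (A jb.1 (sval x)) else scal_im (A jb.1 (sval x)).
have coB jb x : `|co jb x| <= \sum_j rnorm (A j).
  apply: (@le_trans _ _ (rnorm (A jb.1))); last first.
    by rewrite (bigD1 jb.1)//= lerDl sumr_ge0// => j _; exact: rnorm_ge0.
  apply: le_trans (mlin_rnorm_le _ (svalP x)); rewrite /co.
  by case: ifP => _; [exact: normr_scal_re|exact: normr_scal_im].
pose D := \sum_j rnorm (Y2 j).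
have D0 : 0 <= D by apply: sumr_ge0 => j _; exact: rnorm_ge0.
have ND0 : 0 < N * D *+ 2 + 1 by rewrite ltr_wpDl// mulrn_wge0// mulr_ge0.
(* Each remainder [r j] will have norm at most 2Nd, so together they contribute at most 2NDd <=
   e. *)
pose d := e / (N * D *+ 2 + 1).
have d0 : 0 < d by exact: divr_gt0.
have [L [c [c_close _]]] := finite_cells coB d0.
pose I : finType := {ffun J * bool -> 'I_L.+1}.
(* Empty cells receive the arbitrary point [s0]; cells that are met receive one of their own
   points. *)
have rep_ex (i : I) : exists y : S, forall x, c x = i -> c y = i.
  have [[x xi]|nx] := pselect (exists x, c x = i); first by exists x.
  by exists s0 => x xi; case: nx; exists x.
have [rep repP] := choice rep_ex.
have crep x : c (rep (c x)) = c x by exact: (repP _ x).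
pose a (i : I) (j : J) : K := A j (sval (rep i)).
have a_close x j : rnorm ((A j (sval x) : K) - a (c x) j) <= d + d.
  rewrite (le_trans (rnorm_le_parts _))// scal_reB scal_imB lerD//.
    exact: (c_close _ _ (esym (crep x)) (j, true)).
  exact: (c_close _ _ (esym (crep x)) (j, false)).
have gN (y : J -> F) (B' : R) : (forall i, rnorm (\sum_j a i j *: y j) <= B') ->
    rnorm (\sum_j hyper_borel phi (A j) (y j)) <= N * (B' + (d + d) * \sum_j rnorm (y j)).
  move=> yB.
  have -> : \sum_j hyper_borel phi (A j) (y j) = phi (fr_sum (index_enum J) A y).
    by rewrite /fr_sum linear_sum.
  rewrite (le_trans (clin_rnorm_le _ _))// ler_wpM2l//.
  apply: fr_closure_rnorm_le => x Bx; rewrite fr_sumE.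
  pose x' : S := exist _ x Bx.
  have -> : \sum_j A j x *: y j =
      \sum_j a (c x') j *: y j + \sum_j ((A j x : K) - a (c x') j) *: y j.
    by rewrite -big_split/=; apply: eq_bigr => j _; rewrite -scalerDl addrC subrK.
  rewrite (le_trans (rnormD _ _))// lerD//.
  rewrite mulr_sumr (le_trans (rnorm_sum _ _ _))//; apply: ler_sum => j _.
  by rewrite rnormZ ler_wpM2r ?rnorm_ge0//; exact: (a_close x').
have dd0 : 0 <= d + d by rewrite addr_ge0// ltW.
have [h [r [gE hN rN]]] := dual_factorization (c s0) N0 dd0 gN.
(* The zero functional is a point of the ball and makes the tensor function vanish. The sign of [B]
   is what lets the bound on the sum of the norms of the [h i] be multiplied by it. *)
have B0 : 0 <= B.
  have [p1 p1E] : exists p : dual_ball X, dual_ball_val p =1 (fun=> 0).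
    apply: dual_ball_exists => [l x y|x]; first by rewrite scaler0 addr0.
    by rewrite rnorm0 rnorm_ge0.
  have := sB (p1, point); rewrite /tensor_fct big1 ?scal_re0// => z _.
  by rewrite p1E mul0r.
have hB i : scal_re (\sum_j a i j * Y2 j (h i)) <= rnorm (h i) * B.
  have [hi0|hi0] := eqVneq (h i) 0.
    rewrite hi0 rnorm0 mul0r big1 ?scal_re0// => j _.
    by rewrite linear0 mulr0.
  have nh0 : rnorm (h i) != 0 by apply: contra_neq hi0 => /rnorm_eq0.
  (* After normalization, evaluation at [rep i] and evaluation at [h'] form a point of Omega, where
     the assumption on [s] applies. *)
  pose h' := r2K (rnorm (h i))^-1 *: h i.
  have h'1 : rnorm h' <= 1.
    by rewrite rnormZ rnorm_of_real ?invr_ge0 ?rnorm_ge0// mulVf.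
  have hE : h i = r2K (rnorm (h i)) *: h'.
    by rewrite scalerA -scal_of_realM mulfV// scal_of_real1 scale1r.
  have [p1 p1E] := point_eval_dual_ball (svalP (rep i)).
  have [p2 p2E] := dual_eval_dual_ball h'1.
  have -> : \sum_j a i j * Y2 j (h i) = r2K (rnorm (h i)) * tensor_fct s (p1, p2).
    rewrite /tensor_fct (sumJ K (fun x y => dual_ball_val p1 x * dual_ball_val p2 y)).
    rewrite mulr_sumr; apply: eq_bigr => j _; rewrite p1E p2E {1}hE linearZ/= mulrCA.
    by [].
  by rewrite scal_reZ ler_wpM2l ?rnorm_ge0.
have -> : tensor_eval (hyper_borel phi) s =
    \sum_i \sum_j a i j * Y2 j (h i) + \sum_j Y2 j (r j).
  rewrite /tensor_eval (sumJ K (fun x y => y (hyper_borel phi x))).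
  rewrite exchange_big -big_split/=; apply: eq_bigr => j _.
  rewrite (congr1 (Y2 j) (gE j)) linearD linear_sum; congr (_ + _); apply: eq_bigr => i _.
  by rewrite linearZ.
rewrite scal_reD lerD//.
  rewrite scal_re_sum (le_trans (ler_sum _ (fun i _ => hB i)))//.
  by rewrite -mulr_suml ler_wpM2r.
rewrite (le_trans (scal_re_le_rnorm _))// (le_trans (rnorm_sum _ _ _))//.
apply: (@le_trans _ _ (\sum_j rnorm (Y2 j) * (N * (d + d)))).
  apply: ler_sum => j _; rewrite (le_trans (clin_rnorm_le _ _))//.
  by rewrite ler_wpM2l ?rnorm_ge0.
rewrite -mulr_suml -/D.
have -> : D * (N * (d + d)) = d * (N * D *+ 2) by rewrite -mulr2n; ring.
rewrite /d mulrAC ler_pdivrMr// ler_wpM2l ?(ltW e0)//.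
by rewrite lerDl.
Qed.

Theorem hyper_borel_measure phi : exists mu, [/\ regular_measure mu,
  represents mu (hyper_borel phi) & (Defs.variation mu setT <= (rnorm phi)%:E)%E].
Proof.
apply: integral_of_dominated; first exact: rnorm_ge0.
by move=> s B; exact: hyper_borel_dominated.
Qed.

End HyperBorelIsometry.

(** * From integral operators back to functionals, and the equality of norms *)

Section IntegralOperators.
Context {R : realType} {k : scalar_kind}.
Local Notation K := (scalar_field R k).
Local Notation r2K := (@scal_of_real R k).
Context {n : nat} {E : 'I_n -> completeNormedModType K} {F : normedModType K}.
Local Notation X := (mlin E K^o).
Local Notation Y := (dual F).
Implicit Types (phi : dual (fr_closure E F)) (u : clin X Y).

Lemma dual_evaluation (V : normedModType K) (v : V) :
  exists e : dual (dual V), forall g, e g = g v.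
Proof.
have lv : linear (fun g : dual V => g v : K^o) by [].
have bv (g : dual V) : rnorm (g v : K^o) <= rnorm v * rnorm g.
  by rewrite mulrC; exact: clin_rnorm_le.
by exists (CLin (linear_bounded_clin_pred lv bv)).
Qed.

(** At a point (p, q) of Omega the integrand is [p] applied to the form with value q(e) at x, where
    e is the canonical image in F^** of the value of the operator at x. Two contractions, by [p] and
    then by [q], bound it by the operator norm. The constant is abstract so as to serve both for the
    crude bound and for the total variation. *)
Lemma integral_fr_sum_bound u mu (C : R) : 0 <= C -> represents mu u ->
  (forall f M, scal_bounded_measurable f -> (forall p, rnorm (f p) <= M) ->
    rnorm (measure_integral mu f) <= C * M) ->
  forall (W : Type) (s : seq W) (A : W -> X) (y : W -> F),
    rnorm (\sum_(w <- s) u (A w) (y w)) <= C * rnorm (fr_sum s A y).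
Proof.
move=> C0 muu muC W s A y.
have [Jy JyE] := choice (fun w => dual_evaluation (y w)).
have -> : \sum_(w <- s) u (A w) (y w) = measure_integral mu (fun p =>
    \sum_(w <- s) dual_ball_val p.1 (A w) * dual_ball_val p.2 (Jy w)).
  rewrite measure_integral_sum => [|w]; last exact: eval_product_bounded_measurable.
  by apply: eq_bigr => w _; rewrite -muu JyE.
apply: muC => [|[p q] /=].
  by apply: scal_bounded_measurable_sum => w; exact: eval_product_bounded_measurable.
have -> : \sum_(w <- s) dual_ball_val p (A w) * dual_ball_val q (Jy w) =
    dual_ball_val p (\sum_(w <- s) dual_ball_val q (Jy w) *: A w).
  by rewrite linear_sum; apply: eq_bigr => w _; rewrite linearZ/= mulrC.
rewrite (le_trans (dual_ball_rnorm _ _))// mlin_rnormE.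
apply: (sup_norm_le (@unit_ball_prod_neq0 _ _ _ E)) => x Bx.
have -> : (\sum_(w <- s) dual_ball_val q (Jy w) *: A w : X) x =
    \sum_(w <- s) A w x * dual_ball_val q (Jy w).
  by elim/big_rec2 : _ => // w b c _ <-; congr (_ + _); exact: mulrC.
have [e eE] := dual_evaluation (fr_closure_val (fr_sum s A y) x).
have -> : \sum_(w <- s) A w x * dual_ball_val q (Jy w) = dual_ball_val q e.
  have -> : e = \sum_(w <- s) A w x *: Jy w.
    apply/val_inj/funext => g; change (e g = (\sum_(w <- s) A w x *: Jy w : dual Y) g).
    rewrite eE fr_sumE linear_sum.
    by elim/big_rec2 : _ => // w b c _ ->; rewrite linearZ/= -JyE.
  by rewrite linear_sum; apply: eq_bigr => w _; rewrite linearZ.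
rewrite (le_trans (dual_ball_rnorm _ _))//.
rewrite (le_trans _ (fr_closure_rnorm_ge (fr_sum s A y) Bx))//.
apply: clin_rnorm_le_bound => [|g]; first exact: rnorm_ge0.
by rewrite eE mulrC; exact: clin_rnorm_le.
Qed.

Lemma fr_sum_dense (T : fr_closure E F) (e : R) : 0 < e ->
  exists s : seq (X * F), rnorm (T - fr_sum s fst snd) < e.
Proof.
move=> e0; have e0' : 0 < r2K e by rewrite -(scal_of_real0 (k := k)) scal_of_real_lt.
have /fr_closureP/fr_closure_eps/(_ _ e0')[S [m [c [A [y ->]]]] TS] := fr_closure_valP T.
exists [seq (c j *: A j, y j) | j <- index_enum 'I_m].
rewrite -(scal_of_real_lt (k := k)) rnormE.
apply: le_lt_trans TS; rewrite le_eqVlt; apply/orP; left; apply/eqP.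
change (`|fr_closure_val T - fr_closure_val
  (fr_sum [seq (c j *: A j, y j) | j <- index_enum 'I_m] fst snd)| =
  `|fr_closure_val T - \sum_(j < m) c j *: tens (A j) (y j)|).
congr (`|_ - _|); apply/val_inj/funext => x.
change (fr_closure_val (fr_sum [seq (c j *: A j, y j) | j <- index_enum 'I_m] fst snd) x =
  (\sum_(j < m) c j *: tens (A j) (y j) : mlin E F) x).
rewrite fr_sumE big_map; elim/big_rec2 : _ => // j b v _ ->.
congr (_ + _); change ((c j * A j x) *: y j = c j *: (A j x *: y j)).
by rewrite scalerA.
Qed.

Lemma fr_tensZl (l : K) (A : X) (y : F) : fr_tens (l *: A) y = l *: fr_tens A y.
Proof.
do 2 apply: val_inj; apply/funext => x.
change ((l * A x) *: y = l *: (A x *: y)).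
by rewrite scalerA.
Qed.

Lemma hyper_borel_linear : linear (@hyper_borel R k n E F).
Proof. by move=> a phi psi; do 2 (apply/val_inj/funext => ?). Qed.

Lemma hyper_borel_fr_sum phi (W : Type) (s : seq W) (A : W -> X) (y : W -> F) :
  phi (fr_sum s A y) = \sum_(w <- s) hyper_borel phi (A w) (y w).
Proof. by rewrite /fr_sum linear_sum. Qed.

(** Finite sums of elementary tensors are dense and [phi] is already continuous, so a bound on them
    passes to the whole closure. *)
Lemma dual_fr_closure_rnorm_le phi (C : R) : 0 <= C ->
  (forall s : seq (X * F), rnorm (phi (fr_sum s fst snd)) <= C * rnorm (fr_sum s fst snd)) ->
  rnorm phi <= C.
Proof.
move=> C0 phiC; apply: clin_rnorm_le_bound => // T.
apply/ler_addgt0Pr => e e0.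
have D0 : 0 < rnorm phi + C + 1 by rewrite ltr_wpDl// addr_ge0// rnorm_ge0.
have [s sT] := fr_sum_dense T (divr_gt0 e0 D0).
set S := fr_sum s fst snd in sT.
have SE : rnorm S <= rnorm T + rnorm (T - S).
  rewrite -[in leLHS](subrK T S) addrC (le_trans (rnormD _ _))// lerD2l.
  by rewrite /rnorm -opprB normrN.
rewrite -(subrK S T) linearD (le_trans (rnormD _ _))//.
apply: (@le_trans _ _ (rnorm phi * rnorm (T - S) + C * (rnorm T + rnorm (T - S)))).
  rewrite lerD ?clin_rnorm_le// (le_trans (phiC s))// ler_wpM2l//.
rewrite subrK mulrDr addrCA lerD2l -mulrDl.
apply: (@le_trans _ _ ((rnorm phi + C) * (e / (rnorm phi + C + 1)))).
  by rewrite ler_wpM2l ?addr_ge0 ?rnorm_ge0// ltW.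
by rewrite mulrA ler_pdivrMr// mulrC ler_wpM2l ?(ltW e0)// lerDl.
Qed.

Lemma hyper_borel_inj : injective (@hyper_borel R k n E F).
Proof.
move=> phi psi eq_hb; apply/eqP; rewrite -subr_eq0; apply/eqP/rnorm_eq0/eqP.
(* Injectivity is the density bound with constant 0 for the difference. *)
rewrite eq_le rnorm_ge0 andbT; apply: dual_fr_closure_rnorm_le => // s.
change (rnorm (phi (fr_sum s fst snd) - psi (fr_sum s fst snd)) <=
  0 * rnorm (fr_sum s fst snd)).
by rewrite !hyper_borel_fr_sum eq_hb subrr rnorm0 mul0r.
Qed.

(** The values on sums of tensors are prescribed as a relation dominated by C times the norm, and
    Hahn-Banach extends it to the closure. Here [C] need not be sharp: the exact norm is obtained
    separately. *)
Lemma integral_op_hyper_borel u : integral_op u -> exists phi, hyper_borel phi = u.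
Proof.
move=> [mu _ muu]; have [C C0 muC] := measure_integral_bound mu.
have uC := integral_fr_sum_bound C0 muu muC.
pose G : set (fr_closure E F * K) := [set vc | exists s : seq (X * F),
  vc = (fr_sum s fst snd, \sum_(z <- s) u z.1 z.2)].
have [|l v|||v c [s [-> ->]]|g [gl gb gG]] :=
    @hahn_banach R k (fr_closure E F) (fun T => C * rnorm T) G.
- by move=> v w; rewrite -mulrDr ler_wpM2l// rnormD.
- by rewrite rnormZ mulrCA.
- by exists [::]; rewrite /fr_sum !big_nil.
- move=> l v c w d [s1 [-> ->]] [s2 [-> ->]].
  exists (scale_tensor ( *:%R l) s1 ++ s2).
  rewrite /fr_sum !big_cat !big_map/= scaler_sumr mulr_sumr; congr (_ + _, _ + _).
    by apply: eq_bigr => z _; rewrite fr_tensZl.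
  by apply: eq_bigr => z _; rewrite linearZ.
- exact: uC.
exists (CLin (linear_bounded_clin_pred (gl : linear (g : _ -> K^o)) gb)).
apply/val_inj/funext => A; apply/val_inj/funext => y.
change (g (fr_tens A y) = u A y); apply: gG.
by exists [:: (A, y)]; rewrite /fr_sum !big_seq1.
Qed.

Lemma rnorm_le_integral_norm phi : ((rnorm phi)%:E <= integral_norm (hyper_borel phi))%E.
Proof.
apply: le_ereal_inf_tmp => _ [mu [_ muphi] <-].
have V0 : (0 <= Defs.variation mu setT)%E.
  apply: (@le_trans _ _ (\sum_(j < 1) (rnorm (measure_value mu setT))%:E)%E).
    by rewrite big_ord1 lee_fin rnorm_ge0.
  (* The one-block partition shows that the variation is nonnegative, which excludes the value minus
     infinity; the value plus infinity makes the inequality trivial. *)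
  apply: ereal_sup_ubound; exists 1%N, (fun=> setT); split=> //.
  - by move=> i j _ _ _; rewrite !ord1.
  - by apply/seteqP; split=> // x _; exists ord0.
case muV : (Defs.variation mu setT) V0 => [V| |] // V0; last by rewrite leey.
rewrite lee_fin in V0 *; apply: dual_fr_closure_rnorm_le => // s.
rewrite hyper_borel_fr_sum; apply: (integral_fr_sum_bound V0 muphi) => f M bf fM.
by apply: measure_integral_variation; rewrite ?muV.
Qed.

Lemma integral_norm_hyper_borel phi : integral_norm (hyper_borel phi) = (rnorm phi)%:E.
Proof.
apply/eqP; rewrite eq_le rnorm_le_integral_norm andbT.
have [mu [regmu muphi muV]] := hyper_borel_measure phi.
by apply: le_trans muV; apply: ereal_inf_lbound; exists mu.
Qed.

End IntegralOperators.

Theorem theorem3p1 (R : realType) (k : scalar_kind) (n : nat) (n_gt0 : (0 < n)%N)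
    (E : 'I_n -> completeNormedModType (scalar_field R k))
    (F : completeNormedModType (scalar_field R k)) :
  [/\ linear (@hyper_borel R k n E F),
      set_bij [set: dual (fr_closure E F)]
        [set u : clin (mlin E (scalar_field R k)^o) (dual F) | integral_op u]
        (@hyper_borel R k n E F) &
      forall phi : dual (fr_closure E F),
        integral_norm (hyper_borel phi) = (rnorm phi)%:E].
Proof.
split; [exact: hyper_borel_linear| |exact: integral_norm_hyper_borel].
split=> [phi _|phi psi _ _|u].
- by have [mu [regmu muphi _]] := hyper_borel_measure phi; exists mu.
- exact: hyper_borel_inj.
- by move=> /integral_op_hyper_borel[phi <-]; exists phi.
Qed.
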